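(* Let $\Lambda_1,\Lambda_2,\Lambda_3$ be the groups defined in the context. Each group $\Lambda_i$ ($i\in\{1,2,3\}$) can be decomposed in two ways as an amalgamated product $F_9\ast_{F_{81}}F_9$ such that $F_{81}$ has index $10$ in both factors $F_9$. More precisely, for each $i\in\{1,2,3\}$ there exist injective homomorphisms $j_1,j_3:F_{81}\to F_9\cong\langle s_1,\ldots,s_9\rangle$ and $j_2,j_4:F_{81}\to F_9\cong\langle t_1,\ldots,t_9\rangle$ such that $$[F_9:j_1(F_{81})]=[F_9:j_2(F_{81})]=[F_9:j_3(F_{81})]=[F_9:j_4(F_{81})]=10$$ and $$\Lambda_i\cong\langle s_1,\ldots,s_9,t_1,\ldots,t_9\mid j_1(u_1)=j_2(u_1),\ldots,j_1(u_{81})=j_2(u_{81})\rangle$$ $$\cong\langle s_1,\ldots,s_9,t_1,\ldots,t_9\mid j_3(u_1)=j_4(u_1),\ldots,j_3(u_{81})=j_4(u_{81})\rangle,$$ where $\{u_1,\ldots,u_{81}\}$ are the free generators of $F_{81}$.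
   Context: $F_k$ denotes the free group of rank $k$; $\langle s_1,\ldots,s_9\rangle$ and $\langle t_1,\ldots,t_9\rangle$ denote free groups on the indicated generators. For $i\in\{1,2,3\}$ let $\Gamma_i$ be the group given by the finite presentation $$\Gamma_i=\langle a_1,a_2,a_3,a_4,a_5,b_1,b_2,b_3,b_4,b_5\mid r_1,\ldots,r_{25}\rangle,$$ where the relators depend on $i$ and are listed below. Capital letters denote inverses: $A_k:=a_k^{-1}$, $B_k:=b_k^{-1}$ (so e.g. $r_1=a_1b_1a_2^{-1}b_2^{-1}$). Relators $r_1,\ldots,r_{12}$ (the same for $\Gamma_1,\Gamma_2,\Gamma_3$): $r_1=a_1b_1A_2B_2$, $r_2=a_1b_2A_1B_1$, $r_3=a_1b_3A_2B_3$, $r_4=a_1B_3A_2b_2$, $r_5=a_1B_1A_2b_3$, $r_6=a_2b_2A_2B_1$, $r_7=a_3b_1A_4B_2$, $r_8=a_3b_2A_3B_1$, $r_9=a_3b_3A_4B_3$, $r_{10}=a_3B_3A_4b_2$, $r_{11}=a_3B_1A_4b_3$, $r_{12}=a_4b_2A_4B_1$. Relators $r_{13},\ldots,r_{25}$ for $\Gamma_1$: $r_{13}=a_1b_4a_2B_5$, $r_{14}=a_1b_5A_5b_4$, $r_{15}=a_1B_5a_3B_4$, $r_{16}=a_1B_4a_3b_5$, $r_{17}=a_2b_4A_2b_5$, $r_{18}=a_2b_5a_4B_4$, $r_{19}=a_3b_4a_4b_5$, $r_{20}=a_3B_5a_4b_4$, $r_{21}=a_4B_5A_5B_4$, $r_{22}=a_5b_1A_5b_3$,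 $r_{23}=a_5b_2A_5B_5$, $r_{24}=a_5b_3A_5B_1$, $r_{25}=a_5b_4A_5B_2$. Relators $r_{13},\ldots,r_{25}$ for $\Gamma_2$: $r_{13}=a_1b_4A_4b_5$, $r_{14}=a_1b_5a_2B_5$, $r_{15}=a_1B_5a_3B_4$, $r_{16}=a_1B_4a_2b_4$, $r_{17}=a_2b_5A_3b_4$, $r_{18}=a_2B_4a_4B_5$, $r_{19}=a_3b_4a_4b_4$, $r_{20}=a_3b_5A_5b_5$, $r_{21}=a_4b_5a_5b_5$, $r_{22}=a_5b_1A_5b_3$, $r_{23}=a_5b_2A_5B_1$, $r_{24}=a_5b_3A_5B_4$, $r_{25}=a_5b_4A_5B_2$. Relators $r_{13},\ldots,r_{25}$ for $\Gamma_3$: $r_{13}=a_1b_4a_1b_5$, $r_{14}=a_1B_5a_2B_5$, $r_{15}=a_1B_4A_4B_4$, $r_{16}=a_2b_4a_2b_5$, $r_{17}=a_2B_4A_3B_4$, $r_{18}=a_3b_5a_4B_4$, $r_{19}=a_3B_5A_5B_5$, $r_{20}=a_3B_4a_4b_5$, $r_{21}=a_4B_5a_5B_5$, $r_{22}=a_5b_1a_5b_4$, $r_{23}=a_5b_2A_5b_3$, $r_{24}=a_5b_3A_5b_2$, $r_{25}=a_5B_4a_5B_1$. For each $i$, $\Lambda_i$ is defined as the kernel of the surjective homomorphism $\Gamma_i\to\mathbb{Z}/2\mathbb{Z}\times\mathbb{Z}/2\mathbb{Z}$ with $a_1,\ldots,a_5\mapsto(1+2\mathbb{Z},0+2\mathbb{Z})$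 and $b_1,\ldots,b_5\mapsto(0+2\mathbb{Z},1+2\mathbb{Z})$; it is a normal subgroup of index $4$ in $\Gamma_i$. *)

(* Defs.v *)
(* MathComp's [groupType] (possibly infinite groups) and [{multiplicative _ -> _}]
   are used throughout; classical logic is needed only to form quotients by an
   undecidable normal closure and to speak of cardinals of coset spaces. *)
From HB Require Import structures.
From mathcomp Require Import all_boot all_order all_fingroup all_algebra.
From mathcomp Require Import boolp classical_sets functions cardinality.

Set Implicit Arguments.
Unset Strict Implicit.
Unset Printing Implicit Defensive.

Local Open Scope group_scope.

(* Every map preserving products between groups preserves 1 and inverses. *)
Section Morphisms.
Variables (G H : groupType) (f : {multiplicative G -> H}).

Lemma hom1 : f 1 = 1.
Proof. by apply: (@mulgI _ (f 1)); rewrite -gmulfM !mulg1. Qed.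

Lemma homV x : f x^-1 = (f x)^-1.
Proof. by apply: (@mulgI _ (f x)); rewrite -gmulfM !mulgV hom1. Qed.

Lemma homJ x y : f (x ^ y) = f x ^ f y.
Proof. by rewrite /conjg !gmulfM homV. Qed.

Definition ker : pred G := fun x => f x == 1.

Lemma ker_group_closed : group_closed ker.
Proof.
split=> [|x y]; rewrite !unfold_in /ker ?hom1 //.
by move=> /eqP fx /eqP fy; rewrite gmulfM homV fx fy divg1.
Qed.

Record kernel := Kernel { kernel_val :> G; _ : ker kernel_val }.

HB.instance Definition _ := [isSub for kernel_val].
HB.instance Definition _ := [Choice of kernel by <:].
HB.instance Definition _ :=
  SubChoice_isSubGroup.Build G ker kernel ker_group_closed.

End Morphisms.

(* The number of left cosets x H is n; H is meant to be a subgroup. *)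
Definition has_index (G : groupType) (H : set G) (n : nat) : Prop :=
  ([set [set (x * h)%g | h in H] | x in [set: G]] #= `I_n)%classic%card.

(* A letter is a generator (x, false) or the inverse (x, true) of a generator. *)
Section FreeGroup.
Variable X : choiceType.
Implicit Types (l m : X * bool) (u v w : seq (X * bool)).

Definition linv l : X * bool := (l.1, ~~ l.2).

Definition reduced w : bool := sorted (fun l m => m != linv l) w.

Definition red_cons l w : seq (X * bool) :=
  if w is m :: w' then if m == linv l then w' else l :: w else [:: l].

Definition reduce w : seq (X * bool) := foldr red_cons [::] w.

Definition winv w : seq (X * bool) := rev (map linv w).

Record FreeGroup := FreeWord { word_of :> seq (X * bool); _ : reduced word_of }.

HB.instance Definition _ := [isSub for word_of].
HB.instance Definition _ := [Choice of FreeGroup by <:].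

Lemma linvK : involutive linv.
Proof. by case=> x b; rewrite /linv /= negbK. Qed.

Lemma winvK : involutive winv.
Proof. by move=> w; rewrite /winv map_rev revK mapK //; apply: linvK. Qed.

Lemma reduced_red_cons l w : reduced w -> reduced (red_cons l w).
Proof.
case: w => [|m w] //= rw; case: eqP => [_|/eqP ne]; first exact: path_sorted rw.
by rewrite /= ne.
Qed.

Lemma reduced_foldr u v : reduced v -> reduced (foldr red_cons v u).
Proof. by move=> rv; elim: u => //= l u; apply: reduced_red_cons. Qed.

Lemma reduced_reduce w : reduced (reduce w).
Proof. exact: reduced_foldr. Qed.

Lemma red_consK l w : reduced w -> red_cons l (red_cons (linv l) w) = w.
Proof.
case: w => [_|m w] /=; first by rewrite eqxx.
rewrite linvK; case: eqP => [-> {m}|_ _]; last by rewrite /= eqxx.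
by case: w => [|m w] //= /andP[/negPf ->].
Qed.

Lemma reduce_id w : reduced w -> reduce w = w.
Proof.
elim: w => //= l w IH rw; have {}IH := IH (path_sorted rw).
by rewrite IH; case: w rw {IH} => //= m w /andP[/negPf->].
Qed.

Lemma foldr_reduce u v :
  reduced v -> foldr red_cons v (reduce u) = foldr red_cons v u.
Proof.
move=> rv; elim: u => //= l u <-; rewrite -/(reduce u).
case: (reduce u) => //= m w; case: eqP => [->|] //=.
by rewrite red_consK // reduced_foldr.
Qed.

Lemma reduce_catl u v : reduce (reduce u ++ v) = reduce (u ++ v).
Proof. by rewrite /reduce !foldr_cat foldr_reduce // reduced_reduce. Qed.

Lemma reduce_catr u v : reduce (u ++ reduce v) = reduce (u ++ v).
Proof.
by rewrite {1 3}/reduce !foldr_cat -/(reduce _) reduce_id ?reduced_reduce.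
Qed.

Lemma reduced_winv w : reduced w -> reduced (winv w).
Proof.
rewrite /reduced /winv rev_sorted sorted_map.
rewrite (eq_sorted (e' := fun l m => m != linv l)) // => l m /=.
by rewrite linvK eq_sym.
Qed.

Lemma reduce_winvl w : reduce (winv w ++ w) = [::].
Proof.
elim: w => //= l w IH.
rewrite /winv /= rev_cons cat_rcons -reduce_catr /=.
have /= := @red_consK (linv l) (reduce w) (reduced_reduce w).
by rewrite linvK => ->; rewrite reduce_catr.
Qed.

Lemma reduce_winvr w : reduce (w ++ winv w) = [::].
Proof. by rewrite -{1}[w]winvK reduce_winvl. Qed.

(* The element of the free group represented by a not necessarily reduced word. *)
Definition fword w : FreeGroup := FreeWord (reduced_reduce w).

Definition fgen (x : X) : FreeGroup := fword [:: (x, false)].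

Lemma reduced_word (g : FreeGroup) : reduced g.
Proof. by case: g. Qed.

Definition fg_inv (g : FreeGroup) : FreeGroup :=
  FreeWord (reduced_winv (reduced_word g)).

Definition fg_mul (g h : FreeGroup) : FreeGroup := fword (g ++ h).

Lemma fg_mulA : associative fg_mul.
Proof.
by move=> g h k; apply/val_inj; rewrite /= reduce_catl reduce_catr catA.
Qed.

Lemma fg_mul1g : left_id (fword [::]) fg_mul.
Proof. by move=> g; apply/val_inj; rewrite /= reduce_id ?reduced_word. Qed.

Lemma fg_mulg1 : right_id (fword [::]) fg_mul.
Proof. by move=> g; apply/val_inj; rewrite /= cats0 reduce_id ?reduced_word. Qed.

Lemma fg_mulVg : left_inverse (fword [::]) fg_inv fg_mul.
Proof. by move=> g; apply/val_inj; rewrite /= reduce_winvl. Qed.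

Lemma fg_mulgV : right_inverse (fword [::]) fg_inv fg_mul.
Proof. by move=> g; apply/val_inj; rewrite /= reduce_winvr. Qed.

HB.instance Definition _ := isGroup.Build FreeGroup
  fg_mulA fg_mul1g fg_mulg1 fg_mulVg fg_mulgV.

End FreeGroup.

(* The homomorphism out of the free group with prescribed values on generators. *)
Section FreeLift.
Variables (X : choiceType) (G : groupType) (f : X -> G).

Definition lval (l : X * bool) : G := if l.2 then (f l.1)^-1 else f l.1.

Definition wval (w : seq (X * bool)) : G := foldr (fun l g => lval l * g) 1 w.

Definition flift (g : FreeGroup X) : G := wval g.

Lemma wval_cat u v : wval (u ++ v) = wval u * wval v.
Proof. by elim: u => [|l u IH] /=; rewrite ?mul1g // IH mulgA. Qed.

Lemma lval_inv l : lval (linv l) = (lval l)^-1.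
Proof. by case: l => x [] //=; rewrite /lval /= invgK. Qed.

Lemma wval_reduce w : wval (reduce w) = wval w.
Proof.
elim: w => //= l w <-; case: (reduce w) => //= m v.
by case: eqP => [->|] //=; rewrite lval_inv mulKVg.
Qed.

Lemma flift_mul : {morph flift : x y / x * y}.
Proof. by move=> x y; rewrite /flift /= wval_reduce wval_cat. Qed.

HB.instance Definition _ := isMultiplicative.Build _ _ flift flift_mul.

Lemma flift_word w : flift (fword w) = wval w.
Proof. exact: wval_reduce. Qed.

Lemma flift_gen x : flift (fgen x) = f x.
Proof. by rewrite flift_word /= mulg1. Qed.

End FreeLift.

Inductive normal_closure (G : groupType) (R : set G) : set G :=
| ncl_base r : R r -> normal_closure R r
| ncl_one : normal_closure R 1
| ncl_mul x y : normal_closure R x -> normal_closure R y ->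
                normal_closure R (x * y)
| ncl_inv x : normal_closure R x -> normal_closure R x^-1
| ncl_conj x y : normal_closure R x -> normal_closure R (x ^ y).

(* [quot] is the quotient of G by the normal closure of R. *)
Section Quotient.
Variables (G : groupType) (R : set G).
Local Open Scope quotient_scope.

Definition qrel : rel G := fun x y => `[< normal_closure R (x^-1 * y) >].

Lemma qrel_equiv : equiv_class_of qrel.
Proof.
split=> [x|x y|y x z].
- by apply/asboolP; rewrite mulVg; apply: ncl_one.
- by apply/asboolP/asboolP => /ncl_inv; rewrite invgM invgK.
- move=> /asboolP xy /asboolP yz; apply/asboolP.
  by have := ncl_mul xy yz; rewrite mulgA mulgK.
Qed.

Canonical qequiv := EquivRelPack qrel_equiv.

Definition quot : Type := {eq_quot qequiv}.

HB.instance Definition _ := Choice.on quot.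
HB.instance Definition _ := EqQuotient.on quot.

(* [repr] alone is the representative of a coset in fingroup. *)
Local Notation repr := generic_quotient.repr.

Definition qpi (x : G) : quot := \pi x.
Definition qone : quot := qpi 1.
Definition qmul (a b : quot) : quot := qpi (repr a * repr b).
Definition qinv (a : quot) : quot := qpi (repr a)^-1.

Lemma qpiP x y : reflect (qpi x = qpi y) `[< normal_closure R (x^-1 * y) >].
Proof. exact: (@eqquotP _ qequiv _ x y). Qed.

Lemma qpi_repr a : qpi (repr a) = a.
Proof. exact: reprK. Qed.

Lemma qpi_mul : {morph qpi : x y / x * y >-> qmul x y}.
Proof.
move=> x y; apply/esym/qpiP/asboolP; set x' := repr _; set y' := repr _.
have /qpiP/asboolP xx : qpi x' = qpi x by rewrite qpi_repr.
have /qpiP/asboolP yy : qpi y' = qpi y by rewrite qpi_repr.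
suff -> : (x' * y')^-1 * (x * y) = (x'^-1 * x) ^ y' * (y'^-1 * y).
  exact/ncl_mul/yy/ncl_conj.
by rewrite /conjg invgM !mulgA mulgK.
Qed.

Lemma qpi_inv : {morph qpi : x / x^-1 >-> qinv x}.
Proof.
move=> x; apply/qpiP/asboolP; set x' := repr _; rewrite invgK.
have /qpiP/asboolP xx : qpi x' = qpi x by rewrite qpi_repr.
by have := ncl_conj x^-1 xx; rewrite /conjg invgK !mulgA mulgK.
Qed.

Lemma qmulA : associative qmul.
Proof.
move=> a b c; rewrite -[a]qpi_repr -[b]qpi_repr -[c]qpi_repr.
by rewrite -!qpi_mul mulgA.
Qed.

Lemma qmul1g : left_id qone qmul.
Proof. by move=> a; rewrite -[a]qpi_repr -qpi_mul mul1g. Qed.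

Lemma qmulg1 : right_id qone qmul.
Proof. by move=> a; rewrite -[a]qpi_repr -qpi_mul mulg1. Qed.

Lemma qmulVg : left_inverse qone qinv qmul.
Proof. by move=> a; rewrite -[a]qpi_repr -qpi_inv -qpi_mul mulVg. Qed.

Lemma qmulgV : right_inverse qone qinv qmul.
Proof. by move=> a; rewrite -[a]qpi_repr -qpi_inv -qpi_mul mulgV. Qed.

HB.instance Definition _ :=
  isGroup.Build quot qmulA qmul1g qmulg1 qmulVg qmulgV.

HB.instance Definition _ := isMultiplicative.Build G quot qpi qpi_mul.

Section QuotientLift.
Variables (H : groupType) (f : {multiplicative G -> H}).
Hypothesis fR : forall r, R r -> f r = 1.

Definition qlift of (forall r, R r -> f r = 1) : quot -> H :=
  fun a => f (repr a).

Lemma normal_closure_ker x : normal_closure R x -> f x = 1.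
Proof.
elim=> {x} [r /fR //||x y _ fx _ fy|x _ fx|x y _ fx].
- exact: hom1.
- by rewrite gmulfM fx fy mulg1.
- by rewrite homV fx invg1.
- by rewrite homJ fx conj1g.
Qed.

Lemma qlift_pi x : qlift fR (qpi x) = f x.
Proof.
have /qpiP/asboolP/normal_closure_ker : qpi (repr (qpi x)) = qpi x.
  by rewrite qpi_repr.
rewrite gmulfM homV => e; apply: (@mulgI _ (f (repr (qpi x)))^-1).
by rewrite e mulVg.
Qed.

Lemma qlift_mul : {morph qlift fR : a b / a * b}.
Proof.
move=> a b; rewrite -[a]qpi_repr -[b]qpi_repr.
by rewrite -[_ * _]qpi_mul !qlift_pi gmulfM.
Qed.

HB.instance Definition _ := isMultiplicative.Build quot H (qlift fR) qlift_mul.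

End QuotientLift.
End Quotient.

(* < X | R >; an equation u = v between elements of the free group is encoded
   by the relator u / v. *)
Definition presented (X : choiceType) (R : set (FreeGroup X)) : groupType :=
  quot R.

(* The generators are a_1, ..., a_5 (left summand), b_1, ..., b_5 (right
   summand). *)
Definition gens : choiceType := ('I_5 + 'I_5)%type.

Definition o1 : 'I_5 := @Ordinal 5 0 isT.
Definition o2 : 'I_5 := @Ordinal 5 1 isT.
Definition o3 : 'I_5 := @Ordinal 5 2 isT.
Definition o4 : 'I_5 := @Ordinal 5 3 isT.
Definition o5 : 'I_5 := @Ordinal 5 4 isT.

Definition lett (x : gens) (e : bool) : gens * bool := (x, e).

Local Notation a1 := (lett (inl o1) false).
Local Notation a2 := (lett (inl o2) false).
Local Notation a3 := (lett (inl o3) false).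
Local Notation a4 := (lett (inl o4) false).
Local Notation a5 := (lett (inl o5) false).
Local Notation A1 := (lett (inl o1) true).
Local Notation A2 := (lett (inl o2) true).
Local Notation A3 := (lett (inl o3) true).
Local Notation A4 := (lett (inl o4) true).
Local Notation A5 := (lett (inl o5) true).
Local Notation b1 := (lett (inr o1) false).
Local Notation b2 := (lett (inr o2) false).
Local Notation b3 := (lett (inr o3) false).
Local Notation b4 := (lett (inr o4) false).
Local Notation b5 := (lett (inr o5) false).
Local Notation B1 := (lett (inr o1) true).
Local Notation B2 := (lett (inr o2) true).
Local Notation B3 := (lett (inr o3) true).
Local Notation B4 := (lett (inr o4) true).
Local Notation B5 := (lett (inr o5) true).

Definition common_relators : seq (seq (gens * bool)) :=
  [:: [:: a1; b1; A2; B2]; [:: a1; b2; A1; B1]; [:: a1; b3; A2; B3];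
      [:: a1; B3; A2; b2]; [:: a1; B1; A2; b3]; [:: a2; b2; A2; B1];
      [:: a3; b1; A4; B2]; [:: a3; b2; A3; B1]; [:: a3; b3; A4; B3];
      [:: a3; B3; A4; b2]; [:: a3; B1; A4; b3]; [:: a4; b2; A4; B1]].

Definition relators1 : seq (seq (gens * bool)) :=
  [:: [:: a1; b4; a2; B5]; [:: a1; b5; A5; b4]; [:: a1; B5; a3; B4];
      [:: a1; B4; a3; b5]; [:: a2; b4; A2; b5]; [:: a2; b5; a4; B4];
      [:: a3; b4; a4; b5]; [:: a3; B5; a4; b4]; [:: a4; B5; A5; B4];
      [:: a5; b1; A5; b3]; [:: a5; b2; A5; B5]; [:: a5; b3; A5; B1];
      [:: a5; b4; A5; B2]].

Definition relators2 : seq (seq (gens * bool)) :=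
  [:: [:: a1; b4; A4; b5]; [:: a1; b5; a2; B5]; [:: a1; B5; a3; B4];
      [:: a1; B4; a2; b4]; [:: a2; b5; A3; b4]; [:: a2; B4; a4; B5];
      [:: a3; b4; a4; b4]; [:: a3; b5; A5; b5]; [:: a4; b5; a5; b5];
      [:: a5; b1; A5; b3]; [:: a5; b2; A5; B1]; [:: a5; b3; A5; B4];
      [:: a5; b4; A5; B2]].

Definition relators3 : seq (seq (gens * bool)) :=
  [:: [:: a1; b4; a1; b5]; [:: a1; B5; a2; B5]; [:: a1; B4; A4; B4];
      [:: a2; b4; a2; b5]; [:: a2; B4; A3; B4]; [:: a3; b5; a4; B4];
      [:: a3; B5; A5; B5]; [:: a3; B4; a4; b5]; [:: a4; B5; a5; B5];
      [:: a5; b1; a5; b4]; [:: a5; b2; A5; b3]; [:: a5; b3; A5; b2];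
      [:: a5; B4; a5; B1]].

(* Gamma_1, Gamma_2, Gamma_3 are indexed by 0, 1, 2 : 'I_3. *)
Definition relators (i : 'I_3) : seq (seq (gens * bool)) :=
  common_relators ++ nth [::] [:: relators1; relators2; relators3] i.

Definition relator_set (i : 'I_3) : set (FreeGroup gens) :=
  [set fword w | w in [set` relators i]]%classic.

Definition Gamma (i : 'I_3) : groupType := presented (relator_set i).

(* As a group, 'Z_2 is written multiplicatively but carries addition mod 2. *)
Definition parity_gen (x : gens) : 'Z_2 * 'Z_2 :=
  match x with inl _ => (1%R, 0%R) | inr _ => (0%R, 1%R) end.

Lemma parity_relators (i : 'I_3) (r : FreeGroup gens) :
  relator_set i r -> flift parity_gen r = 1.
Proof.
case=> w /= wi <-; rewrite flift_word.
have : all (fun v => wval parity_gen v == 1) (relators i).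
  by case: i {wi} => -[|[|[]]] //= ?; vm_compute.
by move=> /allP/(_ w wi)/eqP.
Qed.

Definition parity (i : 'I_3) : {multiplicative Gamma i -> 'Z_2 * 'Z_2} :=
  qlift (@parity_relators i).

Lemma parityE (i : 'I_3) (x : gens) :
  parity i (qpi (relator_set i) (fgen x)) = parity_gen x.
Proof. exact: etrans (qlift_pi _ _) (flift_gen _ _). Qed.

Definition Lambda (i : 'I_3) : groupType := kernel (parity i).

Definition F9 : groupType := FreeGroup 'I_9.
Definition F81 : groupType := FreeGroup 'I_81.

(* s_1, ..., s_9 (left summand) and t_1, ..., t_9 (right summand). *)
Definition st_gens : choiceType := ('I_9 + 'I_9)%type.

Definition in_s : F9 -> FreeGroup st_gens :=
  flift (fun k : 'I_9 => fgen (inl k : st_gens)).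
Definition in_t : F9 -> FreeGroup st_gens :=
  flift (fun k : 'I_9 => fgen (inr k : st_gens)).

Section Amalgam.
Variables j j' : {multiplicative F81 -> F9}.

(* The relators of the equations j u_k = j' u_k, where u_1, ..., u_81 are the
   free generators of F_81. *)
Definition amalgam_relators : set (FreeGroup st_gens) :=
  [set (in_s (j (fgen k)) * (in_t (j' (fgen k)))^-1)%g
    | k in [set: 'I_81]]%classic.

Definition amalgam : groupType := presented amalgam_relators.

Variables (L : groupType) (f : {multiplicative amalgam -> L}).

Definition factor_s : set L :=
  [set f (qpi amalgam_relators (in_s x)) | x in [set: F9]]%classic.
Definition factor_t : set L :=
  [set f (qpi amalgam_relators (in_t x)) | x in [set: F9]]%classic.

End Amalgam.

Definition conj_set (L : groupType) (A : set L) (g : L) : set L :=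
  [set (x ^ g)%g | x in A]%classic.

(* Two decompositions of L count as one if conjugation by some element of L
   maps the unordered pair of factors of the first to that of the second. *)
Definition same_decomposition (L : groupType)
    (j1 j2 j3 j4 : {multiplicative F81 -> F9})
    (f : {multiplicative amalgam j1 j2 -> L})
    (f' : {multiplicative amalgam j3 j4 -> L}) : Prop :=
  exists g : L,
    (conj_set (factor_s f) g = factor_s f' /\
     conj_set (factor_t f) g = factor_t f') \/
    (conj_set (factor_s f) g = factor_t f' /\
     conj_set (factor_t f) g = factor_s f').

(* Main.v *)
From HB Require Import structures.
Require Import Defs.
From mathcomp Require Import all_boot all_order all_fingroup all_algebra.
From mathcomp Require Import zify.
From mathcomp Require Import boolp classical_sets functions cardinality.

Set Implicit Arguments.
Unset Strict Implicit.
Unset Printing Implicit Defensive.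

Local Open Scope group_scope.

(* Rewriting xy = y'x' along the squares turns the presentation complex of
   Gamma_i into a complex covered by a product of two 10-regular trees. In its
   four-fold cover X, with group Lambda_i, the vertical edges (b-letters) form
   two graphs with two vertices and ten edges each, whose fundamental groups
   are <s> and <t>; the horizontal edges (a-letters) join the first graph to
   the second, and their middle graph, with 20 vertices and 100 edges (the
   squares), is a 10-fold covering of both. So F81 is its fundamental group and
   j1, j2 are induced by the two coverings, all computed from a spanning tree.
   The amalgam T maps to Gamma_i. Labelling the edges of X by elements of T lets
   Gamma_i act on T x {vertices of X}, which gives injectivity and the image.
   Exchanging a and b gives the second splitting; it differs from the first
   because Gamma_i acts on the tree of a-words so that conjugates of b-words
   have fixed points, while a_1^2 has none. *)

(** * Corner tables and spanning trees *)

Definition letter : Type := 'I_5 * bool.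

Definition letters : seq letter :=
  [seq (k, e) | k <- [:: o1; o2; o3; o4; o5], e <- [:: false; true]].

Lemma mem_ord5 (k : 'I_5) : k \in [:: o1; o2; o3; o4; o5].
Proof. by case: k => -[|[|[|[|[|]]]]] lk. Qed.

Lemma mem_letters (y : letter) : y \in letters.
Proof.
case: y => k e; apply/allpairsP; exists (k, e); split; rewrite ?mem_ord5 //.
by case: e.
Qed.

Definition table : Type := seq (letter * letter * (letter * letter)).

(** The entry at [(x, y)] is the pair (y', x') of the square xy = y'x'; x and x' are its horizontal
    sides, y and y' its vertical ones. *)
Definition look (t : table) (x y : letter) : letter * letter :=
  head (x, y) [seq c.2 | c <- t & c.1 == (x, y)].

Definition up (t : table) (x y : letter) := (look t x y).1.
Definition lo (t : table) (x y : letter) := (look t x y).2.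

(** A vertex [(q, x)] of the middle graph is a horizontal edge of X: the one with letter x at
    b-parity q, directed from the first vertical graph to the second. *)
Definition vertex : Type := bool * letter.

Definition vertices : seq vertex :=
  [seq (q, x) | q <- [:: false; true], x <- letters].

Lemma mem_vertices (v : vertex) : v \in vertices.
Proof.
case: v => q x; apply/allpairsP; exists (q, x); split; rewrite ?mem_letters //.
by case: q.
Qed.

Definition base : vertex := (false, (o1, false)).

(** Moving along y at the far end of the edge x slides x across a square. *)
Definition next (t : table) (v : vertex) (y : letter) : vertex :=
  (~~ v.1, lo t v.2 y).

(* Breadth-first search from the base point; depth 5 reaches all 20 vertices. *)
Definition explore (t : table) (s : seq (vertex * seq letter)) :=
  foldl (fun s' c => if c.1 \in unzip1 s' then s' else rcons s' c) s
    [seq (next t c.1 y, rcons c.2 y) | c <- s, y <- letters].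

Definition paths (t : table) := iter 5 (explore t) [:: (base, [::])].

Definition path_to (ps : seq (vertex * seq letter)) (v : vertex) :=
  head [::] [seq c.2 | c <- ps & c.1 == v].

(** In a covering graph, paths from the base point are homotopic iff their words have the same
    reduced form; so this asks whether the edge closes a null-homotopic loop with the tree paths. *)
Definition tree_edge (t : table) ps (v : vertex) (y : letter) : bool :=
  reduce (rcons (path_to ps v) y) == reduce (path_to ps (next t v y)).

Fixpoint tree_path (t : table) ps (v : vertex) (w : seq letter) : bool :=
  if w is y :: w' then tree_edge t ps v y && tree_path t ps (next t v y) w'
  else true.

Definition nontree (t : table) ps : seq (vertex * 'I_5) :=
  [seq e <- [seq (v, k) | v <- vertices, k <- [:: o1; o2; o3; o4; o5]]
         | ~~ tree_edge t ps e.1 (e.2, false)].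

Definition corner_ok (t : table) (x y : letter) : bool :=
  let c := look t x y in
  (look t (linv x) c.1 == (y, linv c.2)) && (look t c.2 (linv y) == (linv c.1, x)).

(** The corner conditions make [next] reversible, the path conditions say that each vertex is
    reached through tree edges, and 81 = 100 - 20 + 1 is the rank of the middle graph. *)
Definition valid (t : table) : bool :=
  let ps := paths t in
  [&& all (fun x => all (corner_ok t x) letters) letters,
      all (fun v => (foldl (next t) base (path_to ps v) == v)
                    && tree_path t ps base (path_to ps v)) vertices,
      path_to ps base == [::]
    & size (nontree t ps) == 81].

(* The four readings xy = y'x' of a square. *)
Definition corners (w : seq letter) : table :=
  if w is [:: x1; y1; x2; y2] then
    [:: ((x1, y1), (linv y2, linv x2)); ((x2, y2), (linv y1, linv x1));
        ((linv x2, linv y1), (y2, x1)); ((linv x1, linv y2), (y1, x2))]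
  else [::].

Definition forget (l : gens * bool) : letter :=
  (match l.1 with inl k => k | inr k => k end, l.2).

(* d = true exchanges the roles of the a_k and the b_k; after rotation by one
   letter each relator again starts with the horizontal letter. *)
Definition table_of (d : bool) (i : 'I_3) : table :=
  flatten [seq corners (map forget (rot d r)) | r <- relators i].

Lemma valid_table d i : valid (table_of d i).
Proof. by case: i => -[|[|[|//]]] ?; case: d; vm_compute. Qed.

Opaque look paths path_to.

(** * Free groups and cocycles *)

Section FreeGroupFacts.
Variable X : choiceType.
Implicit Types (g h : FreeGroup X) (u v : seq (X * bool)).

Lemma fword_cat u v : fword (u ++ v) = fword u * fword v.
Proof. by apply/val_inj; rewrite /= reduce_catl reduce_catr. Qed.

Lemma fword_nil : fword [::] = 1 :> FreeGroup X.
Proof. by []. Qed.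

Lemma fword_id g : fword g = g.
Proof. by apply/val_inj; rewrite /= reduce_id ?reduced_word. Qed.

Lemma fword_eq u v : reduce u = reduce v -> fword u = fword v.
Proof. by move=> uv; apply/val_inj. Qed.

Lemma word_inj g h : word_of g = word_of h -> g = h.
Proof. exact: val_inj. Qed.

Lemma fword_linv (l : X * bool) : fword [:: linv l] = (fword [:: l])^-1.
Proof. by apply/val_inj. Qed.

Lemma fword_winv u : fword (winv u) = (fword u)^-1.
Proof.
apply: (mulIg (fword u)); rewrite mulVg -fword_cat.
by apply/val_inj; rewrite /= reduce_winvl.
Qed.

Lemma lval_fgen (l : X * bool) : lval (@fgen X) l = fword [:: l].
Proof. by case: l => x []; rewrite /lval //= -fword_linv. Qed.

Lemma fword_cons (l : X * bool) u : fword (l :: u) = fword [:: l] * fword u.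
Proof. by rewrite -cat1s fword_cat. Qed.

Lemma free_ind (P : FreeGroup X -> Prop) :
  P 1 -> (forall x g, P g -> P (fgen x * g)) ->
  (forall x g, P g -> P ((fgen x)^-1 * g)) -> forall g, P g.
Proof.
move=> P1 PM PV g; rewrite -[g]fword_id; elim: (word_of g) => [|l w IH] //.
rewrite fword_cons; case: l => x []; last exact: PM.
by rewrite (fword_linv (x, false)); apply: PV.
Qed.

(** Only preservation of products is assumed, so that composites such as [even_coord] after
    [even_incl] qualify. *)
Lemma free_hom_ext (G : groupType) (f f' : FreeGroup X -> G) :
  {morph f : g h / g * h} -> {morph f' : g h / g * h} ->
  (forall x, f (fgen x) = f' (fgen x)) -> f =1 f'.
Proof.
move=> fM f'M fE.
have f1 : f 1 = 1 by apply: (mulgI (f 1)); rewrite -fM !mulg1.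
have f'1 : f' 1 = 1 by apply: (mulgI (f' 1)); rewrite -f'M !mulg1.
apply: free_ind => [|x g IH|x g IH]; first by rewrite f1 f'1.
  by rewrite fM f'M IH fE.
apply: (mulgI (f (fgen x))).
by rewrite {2}fE -fM -f'M !mulVKg.
Qed.

Lemma lval_hom (G H : groupType) (f : {multiplicative G -> H}) (d : X -> G) l :
  f (lval d l) = lval (f \o d) l.
Proof. by case: l => x []; rewrite /lval //= homV. Qed.

Lemma wval_hom (G H : groupType) (f : {multiplicative G -> H}) (d : X -> G) w :
  f (wval d w) = wval (f \o d) w.
Proof. by elim: w => [|l w IH] /=; rewrite ?hom1 // gmulfM IH lval_hom. Qed.

Lemma flift1 (G : groupType) (d : X -> G) : flift d 1 = 1.
Proof. exact: hom1. Qed.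

Lemma flift_inv (G : groupType) (d : X -> G) g :
  flift d g^-1 = (flift d g)^-1.
Proof. exact: homV. Qed.

Lemma flift_fgen_id g : flift (@fgen X) g = g.
Proof.
move: g; apply: free_hom_ext => [x y|//|x]; first exact: flift_mul.
exact: flift_gen.
Qed.

End FreeGroupFacts.

(* Letters act on the right on W through nx, and lab v y is the label of the
   edge from v to nx v y. *)
Section Cocycle.
Variables (X : choiceType) (W : Type) (M : groupType).
Variables (nx : W -> X * bool -> W) (lab : W -> X * bool -> M).
Implicit Types (v : W) (w : seq (X * bool)) (g h : FreeGroup X).

Definition walk v w : W := foldl nx v w.

Fixpoint label v w : M :=
  if w is y :: w' then lab v y * label (nx v y) w' else 1.

Lemma walk_cat v w1 w2 : walk v (w1 ++ w2) = walk (walk v w1) w2.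
Proof. exact: foldl_cat. Qed.

Lemma label_cat v w1 w2 :
  label v (w1 ++ w2) = label v w1 * label (walk v w1) w2.
Proof. by elim: w1 v => [|y w IH] v /=; rewrite ?mul1g // IH mulgA. Qed.

Hypothesis nxK : forall v y, nx (nx v y) (linv y) = v.

Lemma walk_reduce v w : walk v (reduce w) = walk v w.
Proof.
elim: w v => //= y w IH v; rewrite -IH.
case: (reduce w) => //= m w'; case: eqP => [->|] //=.
by rewrite nxK.
Qed.

Lemma walk_winv v w : walk (walk v w) (winv w) = v.
Proof.
by rewrite -walk_cat -walk_reduce reduce_winvr.
Qed.

Lemma walkM v g h : walk v (g * h) = walk (walk v g) h.
Proof. by rewrite walk_reduce walk_cat. Qed.

Lemma walkV v g : walk v g = v -> walk v g^-1 = v.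
Proof. by move=> {1}<-; rewrite -walkM mulgV. Qed.

Hypothesis labV : forall v y, lab (nx v y) (linv y) = (lab v y)^-1.

Lemma label_reduce v w : label v (reduce w) = label v w.
Proof.
elim: w v => //= y w IH v; rewrite -IH.
case: (reduce w) => //= m w'; case: eqP => [->|] //=.
by rewrite labV nxK mulVKg.
Qed.

Lemma labelM v g h : label v (g * h) = label v g * label (walk v g) h.
Proof. by rewrite label_reduce label_cat. Qed.

Lemma label_winv v w : label (walk v w) (winv w) = (label v w)^-1.
Proof.
by apply: (mulgI (label v w)); rewrite -label_cat -label_reduce reduce_winvr mulgV.
Qed.

(** The factors [r] at consecutive vertices cancel, so the product telescopes. *)
Lemma label_coboundary (N : groupType) (f : M -> N) (d : X -> N)
    (r : W -> N) :
    {morph f : x y / x * y} ->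
    (forall v y, f (lab v y) = r v * lval d y * (r (nx v y))^-1) ->
  forall v w, f (label v w) = r v * wval d w * (r (walk v w))^-1.
Proof.
move=> fM fE v w; elim: w v => [|y w IH] v /=; last first.
  by rewrite fM IH fE !mulgA mulgKV.
by apply: (mulgI (f 1)); rewrite -fM !mulg1 mulgV mulg1.
Qed.

End Cocycle.

(* F9 is the subgroup of even words of the free group on 'I_5, with the
   Schreier generators b_k b_1^-1 (k > 1, reading b_k from the even state) and
   b_1 b_k (reading b_k from the odd state). *)
Definition schreier (q : bool) (k : 'I_5) : F9 :=
  if (q * 5 + k)%N is n.+1 then fgen (inord n) else 1.

Definition even_next (q : bool) (y : letter) : bool := ~~ q.

Definition even_lab (q : bool) (y : letter) : F9 :=
  if y.2 then (schreier (~~ q) y.1)^-1 else schreier q y.1.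

Definition F5 : groupType := FreeGroup 'I_5.

(** Inverts the numbering of [schreier]: indices below 4 stand for b_k b_1^-1 with k > 1, the other
    five for b_1 b_k. *)
Definition even_word (n : 'I_9) : F5 :=
  fword (if (n < 4)%N then [:: (inord n.+1, false); (o1, true)]
         else [:: (o1, false); (inord (n - 4), false)]).

Definition even_incl : {multiplicative F9 -> F5} := flift even_word.

Definition coset_rep (q : bool) : F5 := if q then fgen o1 else 1.

(** An even word is rewritten in the Schreier generators; for an odd word w the result is the
    coordinate of w b_1^-1, which is needed for tree paths of odd length. *)
Definition even_coord (w : seq letter) : F9 := label even_next even_lab false w.

Lemma even_incl_gen n : even_incl (fgen n) = even_word n.
Proof. exact: flift_gen. Qed.

Lemma even_nextK q y : even_next (even_next q y) (linv y) = q.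
Proof. exact: negbK. Qed.

Lemma even_labV q y : even_lab (even_next q y) (linv y) = (even_lab q y)^-1.
Proof. by case: y => k []; rewrite /even_lab /even_next /= ?negbK ?invgK. Qed.

Lemma even_incl_schreier q k :
  even_incl (schreier q k) = coset_rep q * fgen k * (coset_rep (~~ q))^-1.
Proof.
rewrite /schreier; case E: (q * 5 + k)%N => [|n].
  case: q E => // E; have -> : k = o1 by apply/val_inj; exact: E.
  by rewrite hom1 mul1g mulgV.
have ln : (n < 9)%N by have := ltn_ord k; move: E; case: q => /= <-; lia.
rewrite even_incl_gen /even_word inordK //.
case: q E => /= E.
  rewrite mul1n in E; rewrite ltnNge; have -> /= : (3 < n)%N by lia.
  rewrite invg1 mulg1 -fword_cat /=; congr fword; congr [:: _; (_, _)].
  by apply/val_inj; rewrite /= inordK; lia.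
rewrite mul0n add0n in E; rewrite (_ : (n < 4)%N); last by have := ltn_ord k; lia.
rewrite mul1g -fword_winv -fword_cat /=; congr fword; congr [:: (_, _); _].
by apply/val_inj; rewrite /= inordK; have := ltn_ord k; lia.
Qed.

Lemma even_incl_lab q y :
  even_incl (even_lab q y) =
    coset_rep q * lval (@fgen _) y * (coset_rep (even_next q y))^-1.
Proof.
case: y => k []; rewrite /even_lab /lval /even_next /= ?homV even_incl_schreier //.
by rewrite !invgM invgK negbK mulgA.
Qed.

Lemma even_incl_label q w :
  even_incl (label even_next even_lab q w) =
    coset_rep q * fword w * (coset_rep (walk even_next q w))^-1.
Proof.
rewrite (label_coboundary (@gmulfM _ _ even_incl) even_incl_lab); congr (_ * _ * _).
elim: w => [|l w IH] //=; by rewrite IH lval_fgen -fword_cons.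
Qed.

Lemma walk_even_incl q x : walk even_next q (even_incl x) = q.
Proof.
elim/free_ind: x => [|k x IH|k x IH]; first by rewrite hom1.
  rewrite gmulfM (walkM even_nextK) -{2}IH; congr (walk _ _ _).
  rewrite even_incl_gen (walk_reduce even_nextK).
  by case: ifP => _; rewrite /walk /= /even_next negbK.
rewrite gmulfM homV (walkM even_nextK) (walkV even_nextK) //.
rewrite even_incl_gen (walk_reduce even_nextK).
by case: ifP => _; rewrite /walk /= /even_next negbK.
Qed.

Lemma even_coordM x y :
  even_coord (even_incl x * even_incl y) =
  even_coord (even_incl x) * even_coord (even_incl y).
Proof. by rewrite /even_coord (labelM even_nextK even_labV) walk_even_incl. Qed.

(** Reading labels from the even state undoes the inclusion, so the Schreier generators are free. *)
Lemma even_inclK x : even_coord (even_incl x) = x.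
Proof.
move: x; apply: free_hom_ext => // [x y|n].
  by rewrite gmulfM even_coordM.
rewrite even_incl_gen /even_coord (label_reduce even_nextK even_labV).
case: ifP => ln; rewrite /even_lab /= mulg1 /schreier /=.
  by rewrite inordK // mul0n add0n inord_val.
rewrite mul1g inordK; last by have := ltn_ord n; lia.
have -> : ((0 * 5).+4 + (n - 4) = n)%N by lia.
by rewrite inord_val.
Qed.

(** * Coverings *)

(* A connected 10-fold covering of the two-vertex graph with fundamental group
   F9, together with a spanning tree: its fundamental group is free on the
   edges e_k outside the tree. *)
Section Covering.
Variables (nx : vertex -> letter -> vertex) (lab : vertex -> letter -> F81).
Hypothesis nxK : forall v y, nx (nx v y) (linv y) = v.
Hypothesis nx1 : forall v y, (nx v y).1 = ~~ v.1.
Hypothesis labV : forall v y, lab (nx v y) (linv y) = (lab v y)^-1.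
Variables (tree : vertex -> seq letter) (edge : 'I_81 -> vertex * letter).

Definition detour (v : vertex) (y : letter) : seq letter :=
  tree v ++ y :: winv (tree (nx v y)).

Hypothesis tree_base : tree base = [::].
Hypothesis walk_tree : forall v, walk nx base (tree v) = v.
Hypothesis label_tree : forall v, label nx lab base (tree v) = 1.
Hypothesis lab_edge : forall k, lab (edge k).1 (edge k).2 = fgen k.

Variable j : {multiplicative F81 -> F9}.
Hypothesis j_lab : forall v y, j (lab v y) = even_coord (detour v y).

Lemma walk1 v w : (walk nx v w).1 = walk even_next v.1 w.
Proof. by elim: w v => //= y w IH v; rewrite IH nx1. Qed.

Lemma even_incl_even_coord w :
  (walk nx base w).1 = false -> even_incl (even_coord w) = fword w.
Proof. by rewrite walk1 even_incl_label /= => ->; rewrite mul1g invg1 mulg1. Qed.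

Lemma walk_detour v y : walk nx base (detour v y) = base.
Proof.
rewrite walk_cat walk_tree /=.
by have := walk_winv nxK base (tree (nx v y)); rewrite walk_tree.
Qed.

Lemma j_fgen k : even_incl (j (fgen k)) = fword (detour (edge k).1 (edge k).2).
Proof. by rewrite -lab_edge j_lab even_incl_even_coord // walk_detour. Qed.

Lemma walk_j u : walk nx base (even_incl (j u)) = base.
Proof.
elim/free_ind: u => [|k u IH|k u IH]; first by rewrite !hom1.
  by rewrite !gmulfM (walkM nxK) j_fgen (walk_reduce nxK) walk_detour.
rewrite !gmulfM !homV (walkM nxK) (walkV nxK) // j_fgen (walk_reduce nxK).
exact: walk_detour.
Qed.

(** Tree paths have label 1 and the k-th remaining edge has label u_k, so reading the labels along
    the loop of u returns u. This left inverse gives injectivity. *)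
Lemma label_j u : label nx lab base (even_incl (j u)) = u.
Proof.
move: u; apply: free_hom_ext => // [u v|k].
  by rewrite !gmulfM (labelM nxK labV) walk_j.
rewrite j_fgen (label_reduce nxK labV) label_cat label_tree mul1g walk_tree /=.
set v' := nx _ _; have := label_winv nxK labV base (tree v').
by rewrite walk_tree label_tree invg1 lab_edge => ->; rewrite mulg1.
Qed.

Lemma covering_inj : injective j.
Proof. by move=> u v uv; rewrite -[u]label_j uv label_j. Qed.

Lemma j_label w :
  j (label nx lab base w) = even_coord (w ++ winv (tree (walk nx base w))).
Proof.
have H v y : even_incl (j (lab v y)) =
    fword (tree v) * lval (@fgen _) y * (fword (tree (nx v y)))^-1.
  rewrite j_lab even_incl_even_coord ?walk_detour //.
  by rewrite /detour fword_cat fword_cons fword_winv lval_fgen mulgA.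
have jM : {morph (fun u => even_incl (j u)) : u v / u * v}.
  by move=> u v; rewrite !gmulfM.
have := label_coboundary jM H base w; rewrite tree_base mul1g -fword_winv => E.
apply: (can_inj even_inclK); rewrite E even_incl_even_coord; last first.
  rewrite walk_cat; set v := walk nx base w.
  by have := walk_winv nxK base (tree v); rewrite walk_tree => ->.
by rewrite fword_cat -flift_word flift_fgen_id.
Qed.

(** The image is the stabiliser of the base point: by [j_label], a loop is the image of its own
    label, the tree path back being empty. *)
Lemma range_j x : range j x <-> walk nx base (even_incl x) = base.
Proof.
split=> [[u _ <-]|fx]; first exact: walk_j.
exists (label nx lab base (even_incl x)) => //.
by rewrite j_label fx tree_base cats0 even_inclK.
Qed.

Definition fibre (n : nat) : vertex := (false, nth base.2 letters n).

Definition transversal (n : nat) : F9 := even_coord (tree (fibre n)).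

Lemma walk_transversal n : walk nx base (even_incl (transversal n)) = fibre n.
Proof.
by rewrite even_incl_even_coord ?(walk_reduce nxK) walk_tree.
Qed.

Lemma covering_index : has_index (range j) 10.
Proof.
rewrite /has_index card_eq_sym; apply/card_set_bijP.
(* Walks act on the right but the cosets are left cosets, so the representatives are inverses of the
   tree paths to the ten points of the fibre. *)
exists (fun n => [set (transversal n)^-1 * h | h in range j]%classic); split.
- by move=> n _; exists (transversal n)^-1.
- move=> n m /set_mem ln /set_mem lm E.
  have : ([set (transversal n)^-1 * h | h in range j]%classic) (transversal m)^-1.
    rewrite E; exists 1; rewrite ?mulg1 //.
    by apply/range_j; rewrite hom1.
  case=> h /range_j fh Eh.
  have Em : transversal m = h^-1 * transversal n.
    by rewrite -[LHS]invgK -Eh invgM invgK.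
  have /eqP : fibre m = fibre n.
    by rewrite -!walk_transversal Em gmulfM homV (walkM nxK) (walkV nxK).
  rewrite xpair_eqE eqxx /= nth_uniq // => /eqP.
  by [].
- move=> _ [x _ <-].
  (* Even words preserve parity, so x^-1 leads into the fibre, and the point reached selects the
     coset. *)
  have /= fx := walk1 base (even_incl x^-1); rewrite walk_even_incl in fx.
  set v := walk nx base (even_incl x^-1) in fx.
  have vE : fibre (index v.2 letters) = v.
    by rewrite /fibre nth_index ?mem_letters // -fx -surjective_pairing.
  exists (index v.2 letters).
    by have := mem_letters v.2; rewrite -index_mem.
  set y := transversal _.
  have fyx : walk nx base (even_incl (y * x)) = base.
    rewrite gmulfM (walkM nxK) walk_transversal vE /v -(walkM nxK).
    by rewrite -gmulfM mulVg hom1.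
  have fyxV : walk nx base (even_incl (y * x)^-1) = base.
    by rewrite homV (walkV nxK).
  apply/seteqP; split=> _ [h /range_j fh <-].
    exists ((y * x)^-1 * h); last by rewrite invgM mulgA mulVKg.
    by apply/range_j; rewrite gmulfM (walkM nxK) fyxV.
  exists (y * x * h); last by rewrite mulgA mulKg.
  by apply/range_j; rewrite gmulfM (walkM nxK) fyx.
Qed.

End Covering.

(** * Permutation groups *)

Section Permutations.
Variable U : Type.

Record perm_of := Perm {
  fwd : U -> U; bwd : U -> U; fwdK : cancel fwd bwd; bwdK : cancel bwd fwd }.

HB.instance Definition _ := gen_eqMixin perm_of.
HB.instance Definition _ := gen_choiceMixin perm_of.

Lemma perm_ext (s s' : perm_of) : fwd s =1 fwd s' -> s = s'.
Proof.
case: s s' => f g fK gK [f' g' f'K g'K] /= /funext ff'.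
rewrite -ff' in f'K g'K *.
have gg' : g = g' by apply/funext => x; rewrite -{1}[x]g'K fK.
by rewrite -gg' in f'K g'K *; congr Perm; apply: Prop_irrelevance.
Qed.

Definition perm_one : perm_of := @Perm id id (fun=> erefl) (fun=> erefl).
(** Products compose from left to right, so that homomorphisms into [perm_of] are right actions. *)
Definition perm_mul (s s' : perm_of) : perm_of :=
  Perm (can_comp (fwdK s') (fwdK s)) (can_comp (bwdK s) (bwdK s')).
Definition perm_inv (s : perm_of) : perm_of := Perm (bwdK s) (fwdK s).

Lemma perm_mulA : associative perm_mul.
Proof. by move=> s s' s''; apply: perm_ext. Qed.
Lemma perm_mul1 : left_id perm_one perm_mul.
Proof. by move=> s; apply: perm_ext. Qed.
Lemma perm_mulr1 : right_id perm_one perm_mul.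
Proof. by move=> s; apply: perm_ext. Qed.
Lemma perm_mulV : left_inverse perm_one perm_inv perm_mul.
Proof. by move=> s; apply: perm_ext => x; apply: bwdK. Qed.
Lemma perm_mulrV : right_inverse perm_one perm_inv perm_mul.
Proof. by move=> s; apply: perm_ext => x; apply: fwdK. Qed.

HB.instance Definition _ := isGroup.Build perm_of
  perm_mulA perm_mul1 perm_mulr1 perm_mulV perm_mulrV.

Lemma fwdM (s s' : perm_of) u : fwd (s * s') u = fwd s' (fwd s u).
Proof. by []. Qed.

Section OfLetters.
Variables (X : choiceType) (m : X * bool -> U -> U).
Hypothesis mK : forall l, cancel (m l) (m (linv l)).

Definition perm_gen (x : X) : perm_of := Perm (mK (x, false)) (mK (x, true)).

Lemma fwd_lval l : fwd (lval perm_gen l) = m l.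
Proof. by case: l => x []. Qed.

End OfLetters.
End Permutations.

(** * The middle graph *)

Lemma even_coord_fword w : even_coord (fword w) = even_coord w.
Proof. exact: label_reduce even_nextK even_labV _ _. Qed.

Lemma even_coord_winv w :
  walk even_next false w = false -> even_coord (winv w) = (even_coord w)^-1.
Proof.
by move=> ev; have := label_winv even_nextK even_labV false w; rewrite ev.
Qed.

Section Corners.
Variable t : table.
Hypothesis ok : valid t.

Local Notation up := (up t).
Local Notation lo := (lo t).
Local Notation next := (next t).
Local Notation ps := (paths t).
Local Notation tree := (path_to ps).
Local Notation x0 := base.2.

Lemma cornerP x y :
  [/\ up (linv x) (up x y) = y, lo (linv x) (up x y) = linv (lo x y),
      up (lo x y) (linv y) = linv (up x y) & lo (lo x y) (linv y) = x].
Proof.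
have /and4P[/allP/(_ _ (mem_letters x))/allP/(_ _ (mem_letters y)) H _ _ _] := ok.
by case/andP: H; rewrite /up /lo => /eqP -> /eqP ->.
Qed.

Lemma up_linvK x y : up (linv x) (up x y) = y.
Proof. by case: (cornerP x y). Qed.

Lemma up_linvKV x y : up x (up (linv x) y) = y.
Proof. by rewrite -{1}[x]linvK up_linvK. Qed.

Lemma lo_linv x y : lo (linv x) (up x y) = linv (lo x y).
Proof. by case: (cornerP x y). Qed.

Lemma up_lo x y : up (lo x y) (linv y) = linv (up x y).
Proof. by case: (cornerP x y). Qed.

Lemma loK x y : lo (lo x y) (linv y) = x.
Proof. by case: (cornerP x y). Qed.

Lemma walk_tree v : walk next base (tree v) = v.
Proof.
have /and4P[_ /allP/(_ _ (mem_vertices v)) H _ _] := ok.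
by case/andP: H => /eqP.
Qed.

Lemma tree_path_tree v : tree_path t ps base (tree v).
Proof.
have /and4P[_ /allP/(_ _ (mem_vertices v)) H _ _] := ok.
by case/andP: H.
Qed.

Lemma tree_base : tree base = [::].
Proof. by have /and4P[_ _ /eqP] := ok. Qed.

Lemma size_nontree : size (nontree t ps) = 81.
Proof. by have /and4P[_ _ _ /eqP] := ok. Qed.

Lemma nextK v y : next (next v y) (linv y) = v.
Proof. by case: v => q x; rewrite /next /= negbK loK. Qed.

Lemma next1 v y : (next v y).1 = ~~ v.1.
Proof. by []. Qed.

Lemma fword_tree_edge v y :
  tree_edge t ps v y -> fword (detour next tree v y) = 1.
Proof.
move=> /eqP H; rewrite /detour -cat_rcons fword_cat fword_winv.
by rewrite (fword_eq H) mulgV.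
Qed.

Lemma tree_edge_linv v y : tree_edge t ps (next v y) (linv y) = tree_edge t ps v y.
Proof.
have H v' y' : tree_edge t ps v' y' -> tree_edge t ps (next v' y') (linv y').
  rewrite /tree_edge nextK -!cats1 => /eqP E.
  rewrite -reduce_catl -E reduce_catl -catA -reduce_catr.
  by rewrite (reduce_winvr [:: y']) cats0.
by apply/idP/idP => /H //; rewrite nextK linvK.
Qed.

Definition edge_lab (v : vertex) (k : 'I_5) : F81 :=
  if tree_edge t ps v (k, false) then 1
  else fgen (inord (index (v, k) (nontree t ps))).

Definition next_lab (v : vertex) (y : letter) : F81 :=
  if y.2 then (edge_lab (next v y) y.1)^-1 else edge_lab v y.1.

Definition edge (n : 'I_81) : vertex * letter :=
  let e := nth (base, o1) (nontree t ps) n in (e.1, (e.2, false)).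

Lemma next_labV v y : next_lab (next v y) (linv y) = (next_lab v y)^-1.
Proof.
rewrite /next_lab nextK; case: y => k [] //=.
by rewrite invgK.
Qed.

Lemma next_lab_tree_edge v y : tree_edge t ps v y -> next_lab v y = 1.
Proof.
case: y => k [] /=; rewrite /next_lab /edge_lab /=; last by move=> ->.
by rewrite -tree_edge_linv /= => ->; rewrite invg1.
Qed.

Lemma next_lab_edge n : next_lab (edge n).1 (edge n).2 = fgen n.
Proof.
rewrite /next_lab /edge_lab /=; set e := nth _ _ _.
have en : e \in nontree t ps by rewrite mem_nth // size_nontree.
have /negPf-> : ~~ tree_edge t ps e.1 (e.2, false).
  by move: en; rewrite mem_filter => /andP[].
rewrite -surjective_pairing index_uniq ?size_nontree ?inord_val //.
by rewrite filter_uniq.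
Qed.

Lemma label_tree v : label next next_lab base (tree v) = 1.
Proof.
have := tree_path_tree v; elim: (tree v) (base) => //= y w IH v' /andP[yv wv].
by rewrite next_lab_tree_edge // mul1g IH.
Qed.

Lemma edgeP v k : ~~ tree_edge t ps v (k, false) ->
  exists2 n, edge n = (v, (k, false)) & next_lab v (k, false) = fgen n.
Proof.
move=> nt; have vk : (v, k) \in nontree t ps.
  rewrite mem_filter nt; apply/allpairsP; exists (v, k).
  by rewrite mem_vertices mem_ord5.
have lt : (index (v, k) (nontree t ps) < 81)%N.
  by rewrite -size_nontree index_mem.
exists (inord (index (v, k) (nontree t ps))).
  by rewrite /edge inordK // nth_index.
by rewrite /next_lab /edge_lab /= (negPf nt).
Qed.

(** Tree edges are trivial on both sides and reversed edges follow by inversion, so the 81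
    generators suffice. The family [D] is abstract to serve both coverings. *)
Lemma hom_next_lab (D : vertex -> letter -> seq letter) (J : F81 -> F9) :
  {morph J : u v / u * v} ->
  (forall v y, fword (D (next v y) (linv y)) = (fword (D v y))^-1) ->
  (forall v y, tree_edge t ps v y -> fword (D v y) = 1) ->
  (forall v y, walk even_next false (D v y) = false) ->
  (forall n, J (fgen n) = even_coord (D (edge n).1 (edge n).2)) ->
  forall v y, J (next_lab v y) = even_coord (D v y).
Proof.
move=> JM DV Dtree Deven JE.
have J1 : J 1 = 1 by apply: (mulgI (J 1)); rewrite -JM !mulg1.
have JV u : J u^-1 = (J u)^-1.
  by apply: (mulgI (J u)); rewrite -JM !mulgV.
have pos v k : J (next_lab v (k, false)) = even_coord (D v (k, false)).
  case: (boolP (tree_edge t ps v (k, false))) => [tr|/edgeP[n en ->]].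
    by rewrite next_lab_tree_edge // J1 -even_coord_fword Dtree.
  by rewrite JE en.
move=> v [k []] //.
have := pos (next v (k, true)) k.
rewrite -[(k, false)]/(linv (k, true)) next_labV JV.
move=> E; apply: invg_inj; rewrite E -even_coord_winv // -[RHS]even_coord_fword.
by rewrite fword_winv -DV even_coord_fword.
Qed.

(* For a path w below the horizontal edge x of the square complex, the path
   above it; x w = (sweep x w) x' in the group. *)
Fixpoint sweep (x : letter) (w : seq letter) : seq letter :=
  if w is y :: w' then up x y :: sweep (lo x y) w' else [::].

Lemma sweep_cat x w1 w2 :
  sweep x (w1 ++ w2) = sweep x w1 ++ sweep (foldl lo x w1) w2.
Proof. by elim: w1 x => //= y w IH x; rewrite IH. Qed.

(** Each [up x] is injective with inverse [up (linv x)], so letters cancel above the edge exactly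
    when they cancel below it. *)
Lemma sweep_reduce x w : reduce (sweep x w) = sweep x (reduce w).
Proof.
elim: w x => //= y w IH x; rewrite {}IH; case: (reduce w) => //= m w'.
case: (eqVneq m (linv y)) => [->|my]; first by rewrite up_lo eqxx loK.
rewrite ifN //; apply: contra my => /eqP; rewrite -up_lo => E.
by rewrite -(up_linvK (lo x y) m) E up_linvK.
Qed.

Lemma foldl_lo_winv x w : foldl lo (foldl lo x w) (winv w) = x.
Proof.
elim: w x => //= y w IH x.
by rewrite /winv /= rev_cons foldl_rcons -/(winv w) IH loK.
Qed.

Lemma sweep_winv x w : sweep (foldl lo x w) (winv w) = winv (sweep x w).
Proof.
elim: w x => //= y w IH x; rewrite /winv /= !rev_cons -!/(winv _) -!cats1.
by rewrite sweep_cat IH foldl_lo_winv /= up_lo.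
Qed.

Lemma walk_next2 v w : (walk next v w).2 = foldl lo v.2 w.
Proof. by elim: w v => //= y w IH v; rewrite IH. Qed.

(** The same middle graph read along the other vertical side: the square is entered from its
    opposite corner, hence the two inversions. *)
Definition snext (v : vertex) (y : letter) : vertex :=
  (~~ v.1, linv (lo (linv v.2) y)).

Definition snext_lab (v : vertex) (y : letter) : F81 :=
  next_lab v (up (linv v.2) y).

Definition stree (v : vertex) : seq letter := sweep x0 (tree v).

Definition sedge (n : 'I_81) : vertex * letter :=
  ((edge n).1, up (edge n).1.2 (edge n).2).

Lemma snext_up v y : snext v (up v.2 y) = next v y.
Proof. by rewrite /snext lo_linv linvK. Qed.

Lemma snextE v y : snext v y = next v (up (linv v.2) y).
Proof. by rewrite -{1}[y](up_linvKV v.2) snext_up. Qed.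

Lemma snext_lab_up v y : snext_lab v (up v.2 y) = next_lab v y.
Proof. by rewrite /snext_lab up_linvK. Qed.

Lemma snextK v y : snext (snext v y) (linv y) = v.
Proof. by case: v => q x; rewrite /snext /= linvK loK negbK linvK. Qed.

Lemma snext_labV v y : snext_lab (snext v y) (linv y) = (snext_lab v y)^-1.
Proof.
rewrite -next_labV {1}/snext_lab /= linvK up_lo snextE.
by [].
Qed.

Lemma walk_sweep v w : walk snext v (sweep v.2 w) = walk next v w.
Proof. by elim: w v => //= y w IH v; rewrite snext_up -IH. Qed.

Lemma label_sweep v w :
  label snext snext_lab v (sweep v.2 w) = label next next_lab v w.
Proof.
elim: w v => //= y w IH v.
by rewrite snext_up -[lo v.2 y]/((next v y).2) IH snext_lab_up.
Qed.

Lemma foldl_tree v : foldl lo x0 (tree v) = v.2.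
Proof. by rewrite -walk_next2 walk_tree. Qed.

Lemma detour_sweep v y :
  detour snext stree v (up v.2 y) = sweep x0 (detour next tree v y).
Proof.
rewrite /detour snext_up sweep_cat foldl_tree; congr (_ ++ _ :: _).
by have := sweep_winv x0 (tree (next v y)); rewrite foldl_tree.
Qed.

(** * The two embeddings of F81 into F9 *)

Definition j_t : {multiplicative F81 -> F9} :=
  flift (fun n => even_coord (detour next tree (edge n).1 (edge n).2)).

Definition j_s : {multiplicative F81 -> F9} :=
  flift (fun n => even_coord (detour snext stree (sedge n).1 (sedge n).2)).

Lemma j_t_gen n :
  j_t (fgen n) = even_coord (detour next tree (edge n).1 (edge n).2).
Proof. exact: flift_gen. Qed.

Lemma j_s_gen n :
  j_s (fgen n) = even_coord (detour snext stree (sedge n).1 (sedge n).2).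
Proof. exact: flift_gen. Qed.

Lemma fword_detour_linv (nx : vertex -> letter -> vertex) tr v y :
    (forall v y, nx (nx v y) (linv y) = v) ->
  fword (detour nx tr (nx v y) (linv y)) = (fword (detour nx tr v y))^-1.
Proof.
move=> nxK; rewrite /detour nxK !fword_cat !(fword_cons _ (winv _)).
by rewrite !fword_winv fword_linv !invgM !invgK !mulgA.
Qed.

Lemma detour_even v y : walk even_next false (detour next tree v y) = false.
Proof.
by rewrite -[false]/(base.1) -(walk1 next1) (walk_detour nextK walk_tree).
Qed.

Lemma walk_stree v : walk snext base (stree v) = v.
Proof. by rewrite walk_sweep walk_tree. Qed.

Lemma snext1 v y : (snext v y).1 = ~~ v.1.
Proof. by []. Qed.

Lemma detour_s_even v y : walk even_next false (detour snext stree v y) = false.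
Proof.
by rewrite -[false]/(base.1) -(walk1 snext1) (walk_detour snextK walk_stree).
Qed.

Lemma j_t_lab v y : j_t (next_lab v y) = even_coord (detour next tree v y).
Proof.
apply: hom_next_lab => [|v' y'|v' y'|v' y'|n]; first exact: flift_mul.
- exact: fword_detour_linv nextK.
- exact: fword_tree_edge.
- exact: detour_even.
- exact: j_t_gen.
Qed.

Lemma j_s_next_lab v y :
  j_s (next_lab v y) = even_coord (detour snext stree v (up v.2 y)).
Proof.
apply: (hom_next_lab (D := fun v y => detour snext stree v (up v.2 y)))
   => [|v' y'|v' y'|v' y'|n]; first exact: flift_mul.
- by rewrite up_lo -snext_up (fword_detour_linv _ _ _ snextK).
(* The upper detour is the sweep of the lower one, which reduces to the empty word on a tree edge;
   sweeping commutes with reduction. *)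
- rewrite detour_sweep => /fword_tree_edge /(congr1 (@word_of _)) E.
  by apply: fword_eq; rewrite sweep_reduce [X in sweep _ X]E.
- exact: detour_s_even.
- exact: j_s_gen.
Qed.

Lemma j_s_lab v y : j_s (snext_lab v y) = even_coord (detour snext stree v y).
Proof. by rewrite j_s_next_lab up_linvKV. Qed.

Lemma j_t_inj : injective j_t.
Proof.
apply: (covering_inj nextK next1 next_labV walk_tree label_tree
  next_lab_edge j_t_lab).
Qed.

Lemma j_t_index : has_index (range j_t) 10.
Proof.
apply: (covering_index nextK next1 tree_base walk_tree next_lab_edge j_t_lab).
Qed.

Lemma stree_base : stree base = [::].
Proof. by rewrite /stree tree_base. Qed.

Lemma label_stree v : label snext snext_lab base (stree v) = 1.
Proof. by rewrite label_sweep label_tree. Qed.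

Lemma snext_lab_edge n : snext_lab (sedge n).1 (sedge n).2 = fgen n.
Proof. by rewrite snext_lab_up next_lab_edge. Qed.

Lemma j_s_inj : injective j_s.
Proof.
apply: (covering_inj snextK snext1 snext_labV walk_stree label_stree
  snext_lab_edge j_s_lab).
Qed.

Lemma j_s_index : has_index (range j_s) 10.
Proof.
apply: (covering_index snextK snext1 stree_base walk_stree snext_lab_edge j_s_lab).
Qed.

(** * The action on the tree *)

(** The a-word of y^-1 w modulo b-words on the right: a square gives y^-1 x = x'^-1 y'^-1 with x' =
    [lo (linv x) y] and y' = [up (linv x) y], and y' continues through the rest. *)
Fixpoint tree_step (y : letter) (w : seq letter) : seq letter :=
  if w is x :: w' then
    linv (lo (linv x) y) :: tree_step (up (linv x) y) w'
  else [::].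

Lemma tree_step_red_cons x y w :
  tree_step y (red_cons (linv x) w) =
  red_cons (linv (lo x y)) (tree_step (up x y) w).
Proof.
case: w => [|z w] /=; first by rewrite linvK.
rewrite linvK; case: (eqVneq z x) => [->|zx]; first by rewrite lo_linv up_linvK eqxx.
rewrite /= linvK ifN //; apply: contra zx => /eqP E.
have := congr1 (@linv _) E; rewrite !linvK -lo_linv => {}E.
have := loK (linv z) (up x y); rewrite E loK => /(congr1 (@linv _)).
by rewrite !linvK => ->; rewrite eqxx.
Qed.

Lemma tree_step_reduce y w : tree_step y (reduce w) = reduce (tree_step y w).
Proof.
elim: w y => //= x w IH y; rewrite -{1}[x]linvK tree_step_red_cons IH.
by [].
Qed.

Lemma tree_stepK y w : tree_step (linv y) (tree_step y w) = w.
Proof.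
elim: w y => //= x w IH y.
by rewrite linvK loK linvK up_lo IH.
Qed.

Definition treeA (x : letter) (g : F5) : F5 := (fword [:: x])^-1 * g.

Definition treeB (y : letter) (g : F5) : F5 := fword (tree_step y (word_of g)).

Lemma treeAK x : cancel (treeA x) (treeA (linv x)).
Proof. by move=> g; rewrite /treeA fword_linv invgK mulVKg. Qed.

Lemma word_treeB y g : word_of (treeB y g) = tree_step y (word_of g).
Proof. by rewrite /= -tree_step_reduce reduce_id // reduced_word. Qed.

Lemma word_treeA x g : word_of (treeA x g) = red_cons (linv x) (word_of g).
Proof.
rewrite -[in RHS](reduce_id (reduced_word g)) -[RHS]/(reduce (linv x :: word_of g)).
by rewrite /treeA -fword_linv.
Qed.

Lemma treeBK y : cancel (treeB y) (treeB (linv y)).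
Proof. by move=> g; apply: word_inj; rewrite !word_treeB tree_stepK. Qed.

(** This is the square relation between permutations, through which the group will act on the
    tree. *)
Lemma treeAB x y g : treeB y (treeA x g) = treeA (lo x y) (treeB (up x y) g).
Proof.
apply: word_inj; rewrite word_treeA !word_treeB word_treeA.
exact: tree_step_red_cons.
Qed.

(** * The amalgam *)

Lemma in_sM : {morph in_s : x y / x * y}.
Proof. exact: flift_mul. Qed.

Lemma in_tM : {morph in_t : x y / x * y}.
Proof. exact: flift_mul. Qed.

Definition T : groupType := amalgam j_s j_t.

(* The two factors: L false is the image of <s>, L true that of <t>. *)
Definition L (p : bool) (x : F9) : T :=
  qpi (amalgam_relators j_s j_t) (if p then in_t x else in_s x).

Lemma LM p : {morph L p : x y / x * y}.
Proof. case: p => x y; rewrite /L (in_sM, in_tM); exact: qpi_mul. Qed.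

Lemma L1 p : L p 1 = 1.
Proof. by apply: (mulgI (L p 1)); rewrite -LM !mulg1. Qed.

Lemma LV p x : L p x^-1 = (L p x)^-1.
Proof. by apply: (mulgI (L p x)); rewrite -LM !mulgV L1. Qed.

Lemma L_j u : L false (j_s u) = L true (j_t u).
Proof.
move: u; apply: free_hom_ext => [u v|u v|k]; try by rewrite gmulfM LM.
pose r := in_s (j_s (fgen k)) * (in_t (j_t (fgen k)))^-1.
have : qpi (amalgam_relators j_s j_t) r = 1.
  apply/esym/qpiP/asboolP; rewrite invg1 mul1g.
  by apply: ncl_base; exists k.
by rewrite /r gmulfM homV => /eqP; rewrite divg_eq1 => /eqP.
Qed.

(* The value in T of the horizontal edge with label v.2 at height v.1. *)
Definition rung (v : vertex) : T :=
  (L false (even_coord (stree v)))^-1 * L true (even_coord (tree v)).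

Lemma even_coord_detour nx tr v y :
    (forall v y, (nx v y).1 = ~~ v.1) -> (forall v, walk nx base (tr v) = v) ->
    (forall v y, nx (nx v y) (linv y) = v) ->
  even_coord (detour nx tr v y) =
    even_coord (tr v) * even_lab v.1 y * (even_coord (tr (nx v y)))^-1.
Proof.
move=> nx1 trP nxK; rewrite /even_coord /detour label_cat /= mulgA.
have ev v' : walk even_next false (tr v') = v'.1.
  by rewrite -[false]/(base.1) -(walk1 nx1) trP.
rewrite ev; congr (_ * _); rewrite /even_next -(nx1 v y) -ev.
exact: label_winv even_nextK even_labV _ _.
Qed.

(** The relation [L_j] for the label of one edge, with both detours expanded into tree path, edge
    and tree path back. *)
Lemma rung_square q x y :
  rung (q, x) * L true (even_lab q y) =
  L false (even_lab q (up x y)) * rung (~~ q, lo x y).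
Proof.
have := L_j (next_lab (q, x) y); rewrite j_s_next_lab j_t_lab.
rewrite (even_coord_detour _ _ snext1 walk_stree snextK).
rewrite (even_coord_detour _ _ next1 walk_tree nextK) snext_up.
rewrite !LM !LV /rung /= => E.
apply: (mulgI (L false (even_coord (stree (q, x))))).
rewrite -mulgA mulKVg; set v' := (_, lo x y).
by apply: (mulIg (L true (even_coord (tree v')))^-1); rewrite -E !mulgA mulgK.
Qed.

(** From the second vertical graph, the letter x runs backwards along the edge labelled x^-1. *)
Definition shift (p q : bool) (x : letter) : T :=
  if p then (rung (q, linv x))^-1 else rung (q, x).

Definition state : Type := T * (bool * bool).

Definition actA (x : letter) (s : state) : state :=
  (s.1 * shift s.2.1 s.2.2 x, (~~ s.2.1, s.2.2)).

Definition actB (y : letter) (s : state) : state :=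
  (s.1 * L s.2.1 (even_lab s.2.2 y), (s.2.1, ~~ s.2.2)).

Lemma actAK x : cancel (actA x) (actA (linv x)).
Proof.
by case=> m [[] q]; rewrite /actA /shift /= ?linvK (mulgKV, mulgK).
Qed.

Lemma actBK y : cancel (actB y) (actB (linv y)).
Proof.
case=> m [p q]; rewrite /actB /= negbK -[~~ q]/(even_next q y) even_labV LV.
by rewrite mulgK.
Qed.

Lemma actAB x y s : actB y (actA x s) = actA (lo x y) (actB (up x y) s).
Proof.
case: s => m [p q]; rewrite /actA /actB /=; congr (_, _).
rewrite -!mulgA; congr (_ * _); case: p => /=; last exact: rung_square.
(* On the second side the same square is read from x^-1 and [up x y]. *)
have := rung_square q (linv x) (up x y); rewrite up_linvK lo_linv => E.
apply: (mulgI (rung (q, linv x))); rewrite mulKVg mulgA E.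
by rewrite mulgK.
Qed.

(** * The splitting of a group defined by the squares *)

Section Group.
Variables (G : groupType) (alpha beta : 'I_5 -> G).
Hypothesis squares : forall x y,
  lval alpha x * lval beta y = lval beta (up x y) * lval alpha (lo x y).
Hypothesis universal : forall (H : groupType) (a b : 'I_5 -> H),
    (forall x y, lval a x * lval b y = lval b (up x y) * lval a (lo x y)) ->
  exists f : {multiplicative G -> H},
    (forall k, f (alpha k) = a k) /\ (forall k, f (beta k) = b k).
Hypothesis generated : forall P : G -> Prop, P 1 ->
    (forall g x, P g -> P (g * lval alpha x)) ->
    (forall g y, P g -> P (g * lval beta y)) ->
  forall g, P g.

Lemma sweep_rel x w :
  lval alpha x * wval beta w = wval beta (sweep x w) * lval alpha (foldl lo x w).
Proof.
elim: w x => [|y w IH] x /=; first by rewrite mulg1 mul1g.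
by rewrite mulgA squares -mulgA IH mulgA.
Qed.

(** Loops of the second graph are based at the far end of the edge [alpha o1], hence the conjugation
    by it. *)
Definition st_image (z : st_gens) : G :=
  match z with
  | inl n => flift beta (even_word n)
  | inr n => flift beta (even_word n) ^ (alpha o1)^-1
  end.

Lemma st_image_in_s x : flift st_image (in_s x) = flift beta (even_incl x).
Proof.
move: x; apply: free_hom_ext => [x y|x y|n].
- by rewrite in_sM flift_mul.
- by rewrite gmulfM flift_mul.
- by rewrite /in_s !flift_gen even_incl_gen.
Qed.

Lemma st_image_in_t x :
  flift st_image (in_t x) = flift beta (even_incl x) ^ (alpha o1)^-1.
Proof.
move: x; apply: free_hom_ext => [x y|x y|n].
- by rewrite in_tM flift_mul.
- by rewrite gmulfM flift_mul conjMg.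
- by rewrite /in_t !flift_gen even_incl_gen.
Qed.

Lemma even_incl_detour v y :
  flift beta (even_incl (even_coord (detour next tree v y))) =
  wval beta (detour next tree v y).
Proof.
rewrite (even_incl_even_coord next1) ?flift_word //.
by rewrite (walk_detour nextK walk_tree).
Qed.

Lemma even_incl_detour_s v y :
  flift beta (even_incl (even_coord (detour snext stree v y))) =
  wval beta (detour snext stree v y).
Proof.
rewrite (even_incl_even_coord snext1) ?flift_word //.
by rewrite (walk_detour snextK walk_stree).
Qed.

Lemma st_image_relators r :
  amalgam_relators j_s j_t r -> flift st_image r = 1.
Proof.
case=> k _ <-; rewrite flift_mul flift_inv st_image_in_s st_image_in_t.
rewrite j_s_gen j_t_gen even_incl_detour even_incl_detour_s.
apply/eqP; rewrite divg_eq1; apply/eqP; rewrite detour_sweep.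
(* The loop w brings the edge [x0] back to itself, so sweeping gives x0 w = (sweep x0 w) x0, which
   is the relator. *)
set w := detour _ _ _ _; have := sweep_rel x0 w.
rewrite -walk_next2 (walk_detour nextK walk_tree) /lval /= => E.
by rewrite /conjg invgK mulgA E mulgK.
Qed.

Definition amalgam_map : {multiplicative T -> G} := qlift st_image_relators.

Lemma amalgam_mapE w : amalgam_map (qpi _ w) = flift st_image w.
Proof. exact: qlift_pi. Qed.

Lemma amalgam_map_L p x :
  amalgam_map (L p x) =
  if p then flift beta (even_incl x) ^ (alpha o1)^-1 else flift beta (even_incl x).
Proof. by case: p; rewrite amalgam_mapE ?st_image_in_s ?st_image_in_t. Qed.

(* The action lifts paths to the four-fold cover, whose vertices are
   bool * bool, and multiplies the T-labels of the edges they run through. *)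
Lemma state_action : exists f : {multiplicative G -> perm_of state},
  (forall x, fwd (f (lval alpha x)) = actA x) /\
  (forall y, fwd (f (lval beta y)) = actB y).
Proof.
have [|f [fA fB]] := universal (a := perm_gen actAK) (b := perm_gen actBK).
  by move=> x y; apply: perm_ext => s; rewrite !fwdM !fwd_lval actAB.
exists f; split=> -[k e].
  by rewrite -(fwd_lval actAK); case: e; rewrite /lval /= ?homV fA.
by rewrite -(fwd_lval actBK); case: e; rewrite /lval /= ?homV fB.
Qed.

Local Opaque amalgam_map.

(** * Injectivity and cosets of the map from the amalgam *)

Section Action.
Variable act : {multiplicative G -> perm_of state}.
Hypothesis actA_E : forall x, fwd (act (lval alpha x)) = actA x.
Hypothesis actB_E : forall y, fwd (act (lval beta y)) = actB y.

Lemma act_mul g h s : fwd (act (g * h)) s = fwd (act h) (fwd (act g) s).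
Proof. by rewrite gmulfM. Qed.

Lemma act_wval m p q w :
  fwd (act (wval beta w)) (m, (p, q)) =
    (m * L p (label even_next even_lab q w), (p, walk even_next q w)).
Proof.
elim: w m q => [|y w IH] m q /=; first by rewrite hom1 L1 mulg1.
by rewrite act_mul actB_E /actB /= IH LM mulgA.
Qed.

Lemma act_even m p x :
  fwd (act (flift beta (even_incl x))) (m, (p, false)) = (m * L p x, (p, false)).
Proof.
by rewrite act_wval walk_even_incl -[label _ _ _ _]/(even_coord _) even_inclK.
Qed.

Lemma rung_base : rung base = 1.
Proof. by rewrite /rung stree_base tree_base L1 mulVg. Qed.

Lemma act_in_t m x :
  fwd (act (flift beta (even_incl x) ^ (alpha o1)^-1)) (m, (false, false)) =
    (m * L true x, (false, false)).
Proof.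
rewrite /conjg invgK -[alpha o1]/(lval alpha (o1, false)).
rewrite -[(lval alpha _)^-1]/(lval alpha (o1, true)).
rewrite !act_mul !actA_E /actA /= -/base rung_base mulg1 act_even /=.
by rewrite -/base rung_base invg1 mulg1.
Qed.

Definition acts_as (g : G) (c : T) : Prop :=
  forall m, fwd (act g) (m, (false, false)) = (m * c, (false, false)).

Lemma acts_as1 : acts_as 1 1.
Proof. by move=> m; rewrite hom1 mulg1. Qed.

Lemma acts_asM g h c d : acts_as g c -> acts_as h d -> acts_as (g * h) (c * d).
Proof. by move=> gc hd m; rewrite act_mul gc hd mulgA. Qed.

Lemma acts_asV g c : acts_as g c -> acts_as g^-1 c^-1.
Proof.
by move=> gc m; rewrite -{1}[m](mulgKV c) -gc -act_mul mulgV hom1.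
Qed.

Lemma acts_as_gen z :
  acts_as (flift st_image (fgen z)) (qpi (amalgam_relators j_s j_t) (fgen z)).
Proof.
rewrite flift_gen; case: z => n m /=.
  by rewrite -even_incl_gen act_even /L /in_s flift_gen.
by rewrite -even_incl_gen act_in_t /L /in_t flift_gen.
Qed.

Lemma acts_as_amalgam_map c : acts_as (amalgam_map c) c.
Proof.
rewrite -[c]qpi_repr; move: (generic_quotient.repr c) => w.
rewrite amalgam_mapE; elim/free_ind: w => [|z w IH|z w IH].
- by rewrite flift1 hom1; apply: acts_as1.
- by rewrite flift_mul gmulfM; apply: acts_asM => //; apply: acts_as_gen.
- rewrite flift_mul flift_inv gmulfM homV; apply: acts_asM => //.
  exact/acts_asV/acts_as_gen.
Qed.

(** The T-component of the image of the base state recovers c. *)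
Lemma amalgam_map_inj : injective amalgam_map.
Proof.
move=> c c' E; have := acts_as_amalgam_map c 1.
by rewrite E acts_as_amalgam_map !mul1g => -[].
Qed.

(** A word leading from the base vertex to each of the four vertices of the cover. *)
Definition corner (pq : bool * bool) : G :=
  (if pq.1 then alpha o1 else 1) * (if pq.2 then beta o1 else 1).

(** The element of G that a state stands for. The action becomes right multiplication, which
    expresses every g through the amalgam and a corner. *)
Definition state_val (s : state) : G := amalgam_map s.1 * corner s.2.

Lemma beta_coset_rep q :
  flift beta (coset_rep q) = if q then beta o1 else 1.
Proof. by case: q; rewrite /coset_rep ?flift_gen ?flift1. Qed.

Lemma beta_even_lab q y :
  flift beta (even_incl (even_lab q y)) * flift beta (coset_rep (~~ q)) =
  flift beta (coset_rep q) * lval beta y.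
Proof.
rewrite even_incl_lab /even_next !flift_mul flift_inv mulgKV; congr (_ * _).
by rewrite lval_fgen flift_word /= mulg1.
Qed.

Lemma state_val_actB y s : state_val (actB y s) = state_val s * lval beta y.
Proof.
case: s => m [p q]; rewrite /state_val /actB /corner /= gmulfM amalgam_map_L.
rewrite -!beta_coset_rep -!mulgA -beta_even_lab; congr (_ * _).
by case: p; rewrite ?mul1g // /conjg invgK -!mulgA mulKg.
Qed.

Lemma beta_tree nx tr v :
    (forall v y, (nx v y).1 = ~~ v.1) -> (forall v, walk nx base (tr v) = v) ->
  flift beta (even_incl (even_coord (tr v))) =
    wval beta (tr v) * (flift beta (coset_rep v.1))^-1.
Proof.
move=> nx1 trP; rewrite even_incl_label mul1g flift_mul flift_inv flift_word.
by rewrite -[false]/(base.1) -(walk1 nx1) trP.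
Qed.

(** The image of the rung is b_1^q x b_1^-q a_1^-1, writing a and b for [alpha] and [beta]: sweep
    a_1 along the tree path to [(q, x)]. *)
Lemma amalgam_map_rung q x :
  amalgam_map (rung (q, x)) * alpha o1 * flift beta (coset_rep q) =
  flift beta (coset_rep q) * lval alpha x.
Proof.
rewrite /rung gmulfM homV !amalgam_map_L.
rewrite (beta_tree _ snext1 walk_stree) (beta_tree _ next1 walk_tree) /=.
have := sweep_rel x0 (tree (q, x)); rewrite foldl_tree /= => E.
rewrite /conjg invgK invgM invgK -!mulgA; congr (_ * _).
rewrite mulKg mulVg mulg1.
apply: (mulgI (wval beta (stree (q, x)))); rewrite mulVKg -E.
by rewrite /lval.
Qed.

Lemma state_val_actA x s : state_val (actA x s) = state_val s * lval alpha x.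
Proof.
case: s => m [p q]; rewrite /state_val /actA /corner /= gmulfM.
rewrite -!beta_coset_rep -!mulgA; congr (_ * _); case: p => /=; last first.
  by rewrite mul1g -amalgam_map_rung !mulgA.
rewrite homV mul1g; apply: (mulgI (amalgam_map (rung (q, linv x)))).
rewrite mulVKg !mulgA amalgam_map_rung lval_inv mulgKV.
by [].
Qed.

Lemma state_val_act g s : state_val (fwd (act g) s) = state_val s * g.
Proof.
move: g s; apply: generated => [s|g x IH s|g y IH s].
- by rewrite hom1 mulg1.
- by rewrite act_mul actA_E state_val_actA IH mulgA.
- by rewrite act_mul actB_E state_val_actB IH mulgA.
Qed.

Lemma amalgam_map_corner g : exists c pq, g = amalgam_map c * corner pq.
Proof.
have := state_val_act g (1, (false, false)).
rewrite /state_val /corner /= hom1 !mul1g => <-.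
by case: (fwd _ _) => c pq; exists c, pq.
Qed.

End Action.

(* G acts on the vertices of the tree of alpha-words, and beta-words fix the
   root: this is the Bass-Serre tree of the splitting, extended to G. *)
Lemma conj_beta_neq_alpha2 w g k : flift beta w ^ g <> alpha k * alpha k.
Proof.
have [|f [fA fB]] := universal (a := perm_gen treeAK) (b := perm_gen treeBK).
  by move=> x y; apply: perm_ext => s; rewrite !fwdM !fwd_lval treeAB.
have fBE y : fwd (f (lval beta y)) = treeB y.
  rewrite -(fwd_lval treeBK); case: y => l e.
  by case: e; rewrite /lval /= ?homV fB.
have fix1 v : fwd (f (wval beta v)) 1 = 1.
  elim: v => [|y v IH] /=; first by rewrite hom1.
  by rewrite gmulfM fwdM fBE.
move=> /(congr1 f); rewrite homJ gmulfM fA => E.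
have : fwd (f (flift beta w) ^ f g) (fwd (f g) 1) = fwd (f g) 1.
  by rewrite /conjg !fwdM [fwd (f g)^-1 _]fwdK fix1.
(* The conjugate fixes the translate p of the root, whereas the square of [alpha k] sends p to X^-2
   p; this would force X^2 = 1 in a free group. *)
rewrite E fwdM; set X : F5 := fword [:: (k, false)]; set p := fwd _ 1 => e.
have {}e : X^-1 * (X^-1 * p) = p := e.
have := congr1 (fun z => X * (X * z)) e; rewrite !mulVKg mulgA.
rewrite -{1}[p]mul1g => /mulIg /(congr1 (@word_of _)) /=.
by rewrite xpair_eqE andbF.
Qed.

Variables (H : groupType) (pi : {multiplicative G -> H}) (a b : H).
Hypothesis pi_alpha : forall k, pi (alpha k) = a.
Hypothesis pi_beta : forall k, pi (beta k) = b.
Hypothesis b2 : b * b = 1.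
Hypothesis independent : [/\ a <> 1, b <> 1 & a * b <> 1].

Lemma pi_amalgam_map c : pi (amalgam_map c) = 1.
Proof.
have gen z : pi (flift st_image (fgen z)) = 1.
  rewrite flift_gen; have even n : pi (flift beta (even_word n)) = 1.
    rewrite /even_word flift_word; case: ifP => _ /=;
      by rewrite !gmulfM /lval /= ?homV !pi_beta hom1 mulg1 ?mulgV.
  by case: z => n /=; rewrite ?homJ even ?conj1g.
rewrite -[c]qpi_repr; move: (generic_quotient.repr c) => w.
rewrite amalgam_mapE; elim/free_ind: w => [|z w IH|z w IH].
- by rewrite flift1 hom1.
- by rewrite flift_mul gmulfM gen IH mulg1.
- by rewrite flift_mul flift_inv gmulfM homV gen IH invg1 mulg1.
Qed.

(** The image of the amalgam dies under [pi], and of the four corners only the trivial one does. *)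
Lemma range_amalgam_map g : pi g = 1 -> exists c, amalgam_map c = g.
Proof.
have [act [actA_E actB_E]] := state_action.
have [c [pq ->]] := amalgam_map_corner actA_E actB_E g.
rewrite gmulfM pi_amalgam_map mul1g; case: independent => a1 b1 ab1.
case: pq => [[] []]; rewrite /corner /= ?mulg1 ?mul1g ?gmulfM ?pi_alpha ?pi_beta //.
by exists c.
Qed.

(** The last two clauses identify the factors as even b-words and their conjugates, which later
    separates the two decompositions. *)
Theorem splitting : exists j1 j2 : {multiplicative F81 -> F9},
  [/\ injective j1, injective j2, has_index (range j1) 10
    & has_index (range j2) 10] /\
  exists f : {multiplicative amalgam j1 j2 -> G},
    [/\ injective f, forall g, pi g = 1 <-> exists c, f c = g,
        forall x, f (qpi _ (in_s x)) = flift beta (even_incl x)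
      & forall x,
          f (qpi _ (in_t x)) = flift beta (even_incl x) ^ (alpha o1)^-1].
Proof.
exists j_s, j_t; split.
  by split; [exact: j_s_inj|exact: j_t_inj|exact: j_s_index|exact: j_t_index].
exists amalgam_map; split=> [|g|x|x].
- have [act [actA_E actB_E]] := state_action.
  exact: amalgam_map_inj actA_E actB_E.
- split=> [|[c <-]]; [exact: range_amalgam_map|exact: pi_amalgam_map].
- by rewrite amalgam_mapE st_image_in_s.
- by rewrite amalgam_mapE st_image_in_t.
Qed.

End Group.
End Corners.

(** * The groups Gamma_i *)

Definition is_b (l : gens * bool) : bool := if l.1 is inr _ then true else false.

Definition square_reading (t : table) (d : bool) (r : seq (gens * bool)) : bool :=
  (map is_b r == [:: false; true; false; true]) &&
  if map forget (rot d r) is [:: x1; y1; x2; y2] then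
    (up t x1 y1 == linv y2) && (lo t x1 y1 == linv x2)
  else false.

Definition reads (t : table) (d : bool) (x y : letter)
    (r : seq (gens * bool)) : bool :=
  if map forget (rot d r) is [:: x1; y1; x2; y2] then
    (x, y) \in [:: (x1, y1); (linv x1, linv y2); (linv x2, linv y1); (x2, y2)]
  else false.

Lemma square_readings d i : all (square_reading (table_of d i) d) (relators i).
Proof. by case: i => -[|[|[|//]]] ?; case: d; vm_compute. Qed.

(** Complements [square_readings]: relators are table entries, and every entry comes from a
    relator. *)
Lemma readings_cover d i :
  all (fun x => all (fun y => has (reads (table_of d i) d x y) (relators i))
    letters) letters.
Proof. by case: i => -[|[|[|//]]] ?; case: d; vm_compute. Qed.

Lemma mulg_eq1C (H : groupType) (g h : H) : g * h = 1 <-> h * g = 1.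
Proof.
have imp (x y : H) : x * y = 1 -> y * x = 1.
  by move=> xy; apply: (mulgI x); rewrite mulgA xy mulg1 mul1g.
by split; apply: imp.
Qed.

Section Presentation.
Variables (d : bool) (i : 'I_3).
Local Notation t := (table_of d i).

Definition pgen (k : 'I_5) : gens := if d then inr k else inl k.
Definition qgen (k : 'I_5) : gens := if d then inl k else inr k.

Definition palpha (k : 'I_5) : Gamma i := qpi (relator_set i) (fgen (pgen k)).
Definition pbeta (k : 'I_5) : Gamma i := qpi (relator_set i) (fgen (qgen k)).

Lemma wval_square (H : groupType) (c : gens -> H) r x1 y1 x2 y2 :
    map is_b r = [:: false; true; false; true] ->
    map forget (rot d r) = [:: x1; y1; x2; y2] ->
  wval c r = 1 <->
  lval (c \o pgen) x1 * lval (c \o qgen) y1 =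
    lval (c \o qgen) (linv y2) * lval (c \o pgen) (linv x2).
Proof.
have E (u v w z : H) : u * v = z^-1 * w^-1 <-> u * v * w * z = 1.
  split=> [->|/(canRL (mulgK _)) /(canRL (mulgK _)) ->]; last by rewrite mul1g.
  by rewrite mulgKV mulVg.
rewrite !lval_inv E.
case: r => [|[[k1|k1] e1] [|[[k2|k2] e2] [|[[k3|k3] e3] [|[[k4|k4] e4] [|? ?]]]]] //= _.
rewrite /pgen /qgen /rot /forget /lval; case: (d) => /= -[<- <- <- <-] /=.
  (* For d = true the relator was rotated by one letter, which does not affect its being trivial. *)
  by rewrite mulg1; apply: iff_trans (mulg_eq1C _ _) _; rewrite !mulgA.
by rewrite mulg1 !mulgA.
Qed.

Lemma squareP r : r \in relators i -> exists x1 y1 x2 y2,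
  [/\ map is_b r = [:: false; true; false; true],
      map forget (rot d r) = [:: x1; y1; x2; y2],
      up t x1 y1 = linv y2 & lo t x1 y1 = linv x2].
Proof.
move=> ri; have /allP/(_ r ri)/andP[/eqP sr] := square_readings d i.
case: (map forget _) => [|x1 [|y1 [|x2 [|y2 [|? ?]]]]] // /andP[/eqP u /eqP l].
by exists x1, y1, x2, y2.
Qed.

Lemma wval_relator (H : groupType) (c : gens -> H) r : r \in relators i ->
  (forall x y, lval (c \o pgen) x * lval (c \o qgen) y =
     lval (c \o qgen) (up t x y) * lval (c \o pgen) (lo t x y)) ->
  wval c r = 1.
Proof.
move=> /squareP[x1 [y1 [x2 [y2 [sr fr u l]]]]] sq.
by apply/(wval_square c sr fr); rewrite -u -l.
Qed.

Lemma Gamma_universal (H : groupType) (a b : 'I_5 -> H) :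
    (forall x y, lval a x * lval b y = lval b (up t x y) * lval a (lo t x y)) ->
  exists f : {multiplicative Gamma i -> H},
    (forall k, f (palpha k) = a k) /\ (forall k, f (pbeta k) = b k).
Proof.
move=> sq; pose c (z : gens) :=
  match z with inl k => if d then b k else a k | inr k => if d then a k else b k end.
have cp k : c (pgen k) = a k by rewrite /c /pgen; case: (d).
have cq k : c (qgen k) = b k by rewrite /c /qgen; case: (d).
have cR r : relator_set i r -> flift c r = 1.
  case=> w /= wi <-; rewrite flift_word; apply: wval_relator => // x y.
  by rewrite /lval /= !cp !cq; apply: sq.
exists (qlift cR); split=> k.
  by apply: etrans (qlift_pi cR _) _; apply: etrans (flift_gen _ _) _.
by apply: etrans (qlift_pi cR _) _; apply: etrans (flift_gen _ _) _.
Qed.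

Lemma Gamma_generated (P : Gamma i -> Prop) : P 1 ->
    (forall g x, P g -> P (g * lval palpha x)) ->
    (forall g y, P g -> P (g * lval pbeta y)) ->
  forall g, P g.
Proof.
move=> P1 Pa Pb g; rewrite -[g]qpi_repr; move: (generic_quotient.repr g) => w.
rewrite -[w]fword_id; elim/last_ind: (word_of w) => [|v l IH].
  by rewrite fword_nil hom1.
rewrite -cats1 fword_cat gmulfM -lval_fgen lval_hom.
case: l => [z e].
have [[k zE]|[k zE]] : (exists k, z = pgen k) \/ (exists k, z = qgen k).
- by rewrite /pgen /qgen; case: (d); case: z => k; [right|left|left|right]; exists k.
- by have := Pa _ (k, e) IH; rewrite zE.
- by have := Pb _ (k, e) IH; rewrite zE.
Qed.

(** Each corner is one of the four readings of a relator; [Q1] and [Q2] carry the relation from the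
    first reading to the other three. *)
Lemma Gamma_squares x y :
  lval palpha x * lval pbeta y = lval pbeta (up t x y) * lval palpha (lo t x y).
Proof.
have ok := valid_table d i.
pose Q x y := lval palpha x * lval pbeta y =
  lval pbeta (up t x y) * lval palpha (lo t x y).
have Q1 x' y' : Q x' y' -> Q (linv x') (up t x' y').
  rewrite /Q up_linvK // lo_linv // !lval_inv => E.
  apply: (mulgI (lval palpha x')); rewrite mulVKg mulgA E.
  by rewrite mulgK.
have Q2 x' y' : Q x' y' -> Q (lo t x' y') (linv y').
  rewrite /Q up_lo // loK // !lval_inv => E.
  apply: (mulgI (lval pbeta (up t x' y'))); rewrite mulVKg mulgA -E.
  by rewrite mulgK.
have /allP/(_ _ (mem_letters x))/allP/(_ _ (mem_letters y))/hasP[r ri] :=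
  readings_cover d i.
have [x1 [y1 [x2 [y2 [sr fr u l]]]]] := squareP ri.
have q11 : Q x1 y1.
  rewrite /Q u l; apply/(wval_square (fun z => qpi (relator_set i) (fgen z)) sr fr).
  have <- : qpi (relator_set i) (fword r) = 1.
    apply/esym/qpiP/asboolP; rewrite invg1 mul1g.
    by apply: ncl_base; exists r.
  by rewrite -[fword r]flift_fgen_id flift_word wval_hom.
have q12 := Q1 _ _ q11; have q21 := Q2 _ _ q11; have q22 := Q1 _ _ q21.
rewrite u in q12; rewrite l in q21.
have := up_lo ok x1 y1; rewrite l u linvK => u'.
rewrite l u' linvK in q22.
rewrite /reads fr !inE => /or4P[] /eqP[-> ->].
- exact: q11.
- exact: q12.
- exact: q21.
- exact: q22.
Qed.

End Presentation.

(** * Corestriction to the kernel and the two decompositions *)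

Section Corestriction.
Variables (S G H : groupType) (pi : {multiplicative G -> H}).
Variables (f : {multiplicative S -> G}) (pif : forall s, pi (f s) = 1).

Definition corestrict (s : S) : kernel pi := Kernel (introT eqP (pif s)).

Lemma corestrictM : {morph corestrict : s s' / s * s'}.
Proof. by move=> s s'; apply/val_inj; rewrite /= gmulfM. Qed.

HB.instance Definition _ :=
  isMultiplicative.Build S (kernel pi) corestrict corestrictM.

Lemma corestrict_bij :
  injective f -> (forall g, pi g = 1 -> exists s, f s = g) -> bijective corestrict.
Proof.
move=> f_inj f_surj; rewrite -setTT_bijective; split=> // [s s' _ _ /(congr1 val)|].
  exact: f_inj.
move=> [g kg] _; have [s fs] := f_surj g (eqP kg).
by exists s => //; apply/val_inj.
Qed.

End Corestriction.

Theorem mainTheorem2 (i : 'I_3) :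
  exists j1 j2 j3 j4 : {multiplicative F81 -> F9},
    [/\ injective j1, injective j2, injective j3 & injective j4] /\
    [/\ has_index (range j1) 10, has_index (range j2) 10,
        has_index (range j3) 10 & has_index (range j4) 10] /\
    exists (f : {multiplicative amalgam j1 j2 -> Lambda i})
           (f' : {multiplicative amalgam j3 j4 -> Lambda i}),
      [/\ bijective f, bijective f' & ~ same_decomposition f f'].
Proof.
have split d : exists j1 j2 : {multiplicative F81 -> F9},
  [/\ injective j1, injective j2, has_index (range j1) 10
    & has_index (range j2) 10] /\
  exists f : {multiplicative amalgam j1 j2 -> Gamma i},
    [/\ injective f, forall g, parity i g = 1 <-> exists c, f c = g,
        forall x, f (qpi _ (in_s x)) = flift (@pbeta d i) (even_incl x)
      & forall x, f (qpi _ (in_t x)) =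
          flift (@pbeta d i) (even_incl x) ^ (palpha d i o1)^-1].
  apply: (splitting (valid_table d i) (@Gamma_squares d i) (@Gamma_universal d i)
    (@Gamma_generated d i) (a := parity_gen (pgen d o1))
    (b := parity_gen (qgen d o1))).
  - by move=> k; rewrite parityE; case: (d).
  - by move=> k; rewrite parityE; case: (d).
  - by case: (d); apply/eqP.
  - by case: (d); split; apply/eqP.
have [j1 [j2 [[i1 i2 x1 x2] [f [f_inj f_ker fs ft]]]]] := split false.
have [j3 [j4 [[i3 i4 x3 x4] [f' [f'_inj f'_ker f's f't]]]]] := split true.
have pif c : parity i (f c) = 1 by apply/f_ker; exists c.
have pif' c : parity i (f' c) = 1 by apply/f'_ker; exists c.
exists j1, j2, j3, j4; do 2!split => //.
exists (corestrict pif), (corestrict pif'); split.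
- by apply: corestrict_bij => // g /f_ker.
- by apply: corestrict_bij => // g /f'_ker.
(* With the roles exchanged, this Schreier generator b_1 b_1 becomes a_1^2, which is not conjugate
   to any b-word. *)
pose s : F9 := schreier true o1.
pose z : Lambda i := corestrict pif' (qpi _ (in_s s)).
have zE : val z = palpha false i o1 * palpha false i o1.
  rewrite /= f's even_incl_schreier invg1 mulg1 /coset_rep.
  by rewrite flift_mul flift_gen.
have not_conj w g : flift (@pbeta false i) w ^ g <> val z.
  rewrite zE; exact: (conj_beta_neq_alpha2 (valid_table false i)
    (@Gamma_universal false i)).
(* Either matching of the factors carries one of the first pair onto the s-factor of the second
   splitting, which contains [z]. *)
have not_s g : conj_set (factor_s (corestrict pif)) g <> factor_s (corestrict pif').
  move/seteqP => [_ /(_ z)[]]; first by exists s.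
  move=> _ [x _ <-] /(congr1 val) xg; apply: (not_conj (even_incl x) (val g)).
  by rewrite -xg -fs.
have not_t g : conj_set (factor_t (corestrict pif)) g <> factor_s (corestrict pif').
  move/seteqP => [_ /(_ z)[]]; first by exists s.
  move=> _ [x _ <-] /(congr1 val) xg.
  (* The t-factor consists of b-words conjugated by a_1^-1, which is absorbed into the
     conjugator. *)
  apply: (not_conj (even_incl x) ((palpha false i o1)^-1 * val g)).
  by rewrite -xg conjgM -ft.
by case=> g [] [gs gt]; [exact: not_s gs|exact: not_t gt].
Qed.
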